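(* Let $W$ be a Coxeter group with simple generators $S$, let $\Omega$ be an orientation of its Coxeter diagram $\Gamma$, and let $w\in W$. Then $\pi_\downarrow^{\Omega}(w)$ is the unique maximal (under the weak order) $\Omega$-sortable element weakly below $w$.
   Context: $W$ is a Coxeter group with finite set $S$ of simple generators; $\ell$ is the length function and $e$ the identity. The (right) weak order on $W$ sets $u\le w$ if and only if $\ell(u)+\ell(u^{-1}w)=\ell(w)$. For $J\subseteq S$, $W_J$ is the standard parabolic subgroup generated by $J$. The Coxeter diagram $\Gamma$ is the graph with vertex set $S$ in which distinct $s,t$ are joined by an edge if and only if they do not commute. $\Omega$ is an arbitrary orientation of $\Gamma$ (each edge is given one direction; directed cycles are allowed). A subset $J\subseteq S$ is $\Omega$-acyclic if the induced subgraph of $\Gamma$ on $J$, oriented by $\Omega$, has no directed cycle. For $\Omega$-acyclic $J$, $c(\Omega,J)=s_1s_2\cdots s_k$, where $s_1,\ldots,s_k$ is any ordering of $J$ such that $i<j$ whenever there is an edge oriented $s_j\to s_i$ (the product does not depend on the ordering; $c(\Omega,\emptyset)=e$). $J(w,\Omega)$ denotes the unique maximal (under inclusion) element among the $\Omega$-acyclic subsets $J'\subseteq S$ with $w\ge c(\Omega,J')$ (it is a fact that there is a unique maximal one, which therefore contains all the others). $\Omega$-sortable elements: given $w\in W$, set $w_1=w$ and, inductively, $J_i=J(w_i,\Omega)$, $w_{i+1}=c(\Omega,J_i)^{-1}w_i$ (so $J_i=\emptyset$ for $i$ large). The element $w$ is $\Omega$-sortable if $J_1\supseteq J_2\supseteq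 J_3\supseteq\cdots$. For $w\in W$, $\mathrm{inv}(w)$ is the set of reflections $t$ (conjugates of elements of $S$) with $\ell(tw)<\ell(w)$. For $J\subseteq S$, $w_J$ is the unique element of $W_J$ with $\mathrm{inv}(w_J)=\mathrm{inv}(w)\cap W_J$. The map $\pi_\downarrow^\Omega:W\to W$ is defined recursively by $\pi_\downarrow^\Omega(e)=e$ and, for $w\neq e$, with $J=J(w,\Omega)$, $\pi_\downarrow^{\Omega}(w)=c(\Omega,J)\,\pi_\downarrow^{\Omega}\bigl(c(\Omega,J)^{-1}w_J\bigr)$. *)

(* Defs.v *)
From mathcomp Require Import all_boot.
From mathcomp Require Import boolp classical_sets.

Set Implicit Arguments.
Unset Strict Implicit.
Unset Printing Implicit Defensive.

Local Open Scope group_scope.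

(* The relators of a Coxeter presentation are the words (s t)^(m s t); the
   value m s t = 0 encodes m(s,t) = infinity and gives the empty relator.
   With m s s = 1 the relators include s s, so the monoid presented by them is
   already the group with the same presentation. *)
Inductive coxeter_cong (S : Type) (m : S -> S -> nat) : seq S -> seq S -> Prop :=
| coxeter_cong_refl a : coxeter_cong m a a
| coxeter_cong_sym a b : coxeter_cong m a b -> coxeter_cong m b a
| coxeter_cong_trans a b c :
    coxeter_cong m a b -> coxeter_cong m b c -> coxeter_cong m a c
| coxeter_cong_rel a b s t :
    coxeter_cong m (a ++ flatten (nseq (m s t) [:: s; t]) ++ b) (a ++ b).

Record coxeterSystem (W : groupType) (S : finType) := CoxeterSystem {
  cox_mat : S -> S -> nat;
  cox_gen : S -> W;
  cox_mat_diag : forall s, cox_mat s s = 1%N;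
  cox_mat_offdiag : forall s t, s != t -> cox_mat s t != 1%N;
  cox_mat_sym : forall s t, cox_mat s t = cox_mat t s;
  cox_generated : forall w : W, exists a : seq S, \prod_(s <- a) cox_gen s = w;
  cox_presented : forall a b : seq S,
    \prod_(s <- a) cox_gen s = \prod_(s <- b) cox_gen s
    <-> coxeter_cong cox_mat a b
}.

Section Coxeter.

Variables (W : groupType) (S : finType) (C : coxeterSystem W S).

Local Notation gen := (cox_gen C).

Definition word_prod (a : seq S) : W := \prod_(s <- a) gen s.

Definition has_word (w : W) (n : nat) : bool :=
  [exists a : n.-tuple S, word_prod a == w].

Lemma has_word_ex (w : W) : exists n, has_word w n.
Proof.
have [a aw] := cox_generated C w.
by exists (size a); apply/existsP; exists (in_tuple a); apply/eqP.
Qed.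

Definition cox_length (w : W) : nat := ex_minn (has_word_ex w).

Definition weak_le (u w : W) : bool :=
  (cox_length u + cox_length (u^-1 * w) == cox_length w)%N.

Definition maximal_weak (P : W -> Prop) (v : W) : Prop :=
  P v /\ forall u, P u -> weak_le v u -> u = v.

Definition parabolic (J : {set S}) : set W :=
  smallest (fun H : set W => H 1 /\ forall x y, H x -> H y -> H (x * y^-1))
           (fun x => exists2 s, s \in J & x = gen s).

Definition reflection (t : W) : Prop := exists (s : S) (x : W), t = gen s ^ x.

Definition inversions (w : W) : set W :=
  fun t => reflection t /\ (cox_length (t * w) < cox_length w)%N.

Definition parabolic_part (w : W) (J : {set S}) : W :=
  xget 1 (fun v => parabolic J v /\
    inversions v = (inversions w `&` parabolic J)%classic).

Definition diagram_edge (s t : S) : bool :=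
  (s != t) && (gen s * gen t != gen t * gen s).

(* [o s t] means that the edge joining s and t is directed from s to t. *)
Definition orientation (o : rel S) : Prop :=
  (forall s t, o s t -> diagram_edge s t) /\
  (forall s t, diagram_edge s t -> o s t = ~~ o t s).

Section Orientation.

Variable o : rel S.

Definition acyclic (J : {set S}) : bool :=
  `[< forall p : seq S, p != [::] -> {subset p <= J} -> ~~ cycle o p >].

(* An edge from t to s puts s before t. *)
Definition cox_ordering (J : {set S}) (a : seq S) : Prop :=
  perm_eq a (enum J) /\
  forall s t, s \in J -> t \in J -> o t s -> (index s a < index t a)%N.

(* An ordering exists when J is acyclic, and then the product does not depend
   on it; cox_elt is only used for acyclic J. *)
Definition cox_elt (J : {set S}) : W :=
  word_prod (xget [::] (cox_ordering J)).

Definition Jcand (w : W) (J : {set S}) : bool :=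
  acyclic J && weak_le (cox_elt J) w.

Definition Jmax (w : W) : {set S} :=
  odflt finset.set0 [pick J | maxset (Jcand w) J].

(* [sort_seq w i] is w_(i+1): the indices here start from 0. *)
Definition sort_seq (w : W) (i : nat) : W :=
  iter i (fun u => (cox_elt (Jmax u))^-1 * u) w.

Definition sortable (w : W) : Prop :=
  forall i, Jmax (sort_seq w i.+1) \subset Jmax (sort_seq w i).

(* [pi_graph w v] holds when unfolding the recursion at w ends after finitely
   many steps with the value v. *)
Inductive pi_graph : W -> W -> Prop :=
| pi_graph_1 : pi_graph 1 1
| pi_graph_step w v : w != 1 ->
    pi_graph ((cox_elt (Jmax w))^-1 * parabolic_part w (Jmax w)) v ->
    pi_graph w (cox_elt (Jmax w) * v).

Lemma pi_graph_fun w v v' : pi_graph w v -> pi_graph w v' -> v = v'.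
Proof.
move=> g; elim: g v' => [|{}w {}v w1 _ IH] v' g'.
  by inversion g' as [|w' u w'1]; first by []; rewrite eqxx in w'1.
inversion g' as [w_1|w' u _ gu]; first by rewrite -w_1 eqxx in w1.
by rewrite (IH u gu).
Qed.

(* The recursion ends at every w, since Jmax w contains the left descents of
   w, so that the default value 1 is never used: for w != 1 the argument of the
   recursive call is strictly shorter than w. *)
Definition pi_down (w : W) : W := xget 1 (pi_graph w).

End Orientation.

End Coxeter.

(* Main.v *)
Require Import Defs.
From mathcomp Require Import all_boot all_order all_algebra.
From mathcomp Require Import boolp classical_sets Rstruct reals trigo.
From mathcomp Require Import ring lra zify.

(* Idea. W acts on the real space spanned by the simple roots [al s], and [s] is
   a left descent of [w] iff w^-1 (al s) is negative. For a fixed ordering c of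
   an acyclic set of generators, sortability and the projection become a greedy
   procedure on letters: if the first letter s of c is a descent, divide by it
   and move it to the end of c, otherwise delete it from c. Deleting s records
   the root al s, transported back by the letters taken so far; these are the
   roots C_c^r(v) of Reading and Speyer. The Euler form of c, unitriangular on
   simple roots and invariant under the procedure, shows that if s is last in c
   and not below a c-sortable x, then al s is a nonnegative combination of the
   recorded roots of x, and that if al s is itself recorded then x <= sx.

   Let u be the projection of w and v <= w sortable; by induction, the only
   case that is not immediate is s <= w, s not below v, for s first in c. Go up
   from v to w until s appears, at z < sz <= w, and let x be the projection of z
   for the rotated word, so that v <= x. The recorded roots of x are positive
   at z; they are not all positive at sz, since al s is negative there. But z
   and sz are separated by the wall of al s only, so al s is recorded, hence
   v <= x <= sx, and sx <= u by induction.

   That a largest set J(w) exists is seen on Mozes' numbers game: two acyclic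
   sets can be played together, and if their union contained a directed cycle
   then that cycle could be played forever. *)

Set Implicit Arguments.
Unset Strict Implicit.
Unset Printing Implicit Defensive.

Import Order.TTheory GRing.Theory Num.Theory.

Local Open Scope ring_scope.

(** * Chebyshev numbers *)

Section Chebyshev.

Variable R : realType.
Implicit Types (k th : R) (m n : nat).

(** Chebyshev polynomials of the second kind with the index shifted by one: [cheb k n] is
    U_(n-1)(k/2). *)
Fixpoint cheb k n : R :=
  if n is n1.+1 then
    if n1 is n2.+1 then k * cheb k n1 - cheb k n2 else 1
  else 0.

Lemma chebSS k n : cheb k n.+2 = k * cheb k n.+1 - cheb k n.
Proof. by []. Qed.

Lemma cheb_sin th n : sin th * cheb (2 * cos th) n = sin (n%:R * th).
Proof.
elim/ltn_ind: n => -[_|[_|n IH]]; first by rewrite mul0r sin0 mulr0.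
  by rewrite mul1r mulr1.
rewrite chebSS mulrBr mulrCA !IH //.
have -> : n.+2%:R * th = n.+1%:R * th + th by rewrite -(natr1 n.+1); ring.
have -> : n%:R * th = n.+1%:R * th - th by rewrite -(natr1 n); ring.
rewrite sinB sinD; ring.
Qed.

Lemma cheb2 n : cheb 2 n = n%:R.
Proof.
elim/ltn_ind: n => -[//|[//|n IH]].
by rewrite chebSS !IH // -!natr1; ring.
Qed.

(** Here m = 0 stands for infinity, and 2 is the limit of 2 cos (pi/m). *)
Definition kap m : R := if m == 0%N then 2 else 2 * cos (pi / m%:R).

Lemma sin_pi_div_gt0 m : (1 < m)%N -> 0 < sin (pi / m%:R) :> R.
Proof.
move=> m1; have m0 : 0 < m%:R :> R by rewrite ltr0n ltnW.
apply: sin_gt0_pi; rewrite divr_gt0 ?pi_gt0 //=.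
by rewrite ltr_pdivrMr // ltr_pMr ?pi_gt0 // ltr1n.
Qed.

(** For finite m the number is sin (n pi/m) / sin (pi/m), whose angle stays in [0, pi] as long as n
    <= m; for infinite m it is n. *)
Lemma cheb_kap_ge0 m n : m != 1%N -> (m == 0%N) || (n <= m)%N ->
  0 <= cheb (kap m) n.
Proof.
rewrite /kap; case: (m =P 0%N) => [-> _ _|m0 m1 /= nm]; first by rewrite cheb2.
have {m0 m1}m1 : (1 < m)%N by case: m m0 m1 nm => [|[]].
have m0 : 0 < m%:R :> R by rewrite ltr0n ltnW.
rewrite -(pmulr_rge0 _ (sin_pi_div_gt0 m1)) cheb_sin sin_ge0_pi //.
rewrite mulrA mulr_ge0 ?invr_ge0 ?(ltW m0) ?mulr_ge0 ?pi_ge0 //=.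
by rewrite ler_pdivrMr // mulrC ler_wpM2l ?pi_ge0 // ler_nat.
Qed.

Lemma cheb_kap_eq0 m : m != 1%N -> m != 0%N -> cheb (kap m) m = 0.
Proof.
move=> m1 m0; have {}m1 : (1 < m)%N by case: m m0 m1 => [|[]].
apply: (mulfI (lt0r_neq0 (sin_pi_div_gt0 m1))); rewrite mulr0.
rewrite /kap (negPf m0) cheb_sin mulrC divfK ?sinpi // pnatr_eq0.
by case: (m) m1.
Qed.

Lemma kap_ge0 m : m != 1%N -> 0 <= kap m.
Proof.
move=> m1; have := @cheb_kap_ge0 m 2 m1; rewrite /= mulr1 subr0; apply.
by case: m m1 => [|[]].
Qed.

(** The third Chebyshev number is k^2 - 1, nonnegative when m is infinite or at least 3. The numbers
    game relies on this bound for the weight of an edge. *)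
Lemma kap_ge1 m : m != 1%N -> m != 2%N -> 1 <= kap m.
Proof.
move=> m1 m2; have k0 := kap_ge0 m1.
have : 0 <= cheb (kap m) 3.
  by apply: cheb_kap_ge0 => //; case: m m1 m2 {k0} => [|[|[]]].
by rewrite /= mulr1 subr0 => k1; nra.
Qed.

End Chebyshev.

(* Sealed: only the [realType] structure matters, and nothing should unfold to
   the construction of the real numbers. *)
Fact cfield : realType. Proof. exact: Rdefinitions.R. Qed.

(** * Length and weak order *)

Section Length.

Variables (W : groupType) (S : finType) (C : coxeterSystem W S).
Implicit Types (s t : S) (a b : seq S) (u v w : W).

Local Notation gen := (cox_gen C).
Local Notation wp := (word_prod C).
Local Notation len := (cox_length C).
Local Notation "u <=w v" := (weak_le C u v) (at level 70).

Lemma wp0 : wp [::] = 1%g. Proof. exact: big_nil. Qed.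

Lemma wp_cons s a : wp (s :: a) = (gen s * wp a)%g.
Proof. exact: big_cons. Qed.

Lemma wp_cat a b : wp (a ++ b) = (wp a * wp b)%g.
Proof. exact: big_cat. Qed.

Lemma wp1 s : wp [:: s] = gen s. Proof. exact: big_seq1. Qed.

Lemma wp_rcons a s : wp (rcons a s) = (wp a * gen s)%g.
Proof. by rewrite -cats1 wp_cat wp1. Qed.

Lemma genM s : (gen s * gen s)%g = 1%g.
Proof.
have /(cox_presented C) := coxeter_cong_rel (cox_mat C) [::] [::] s s.
by rewrite cox_mat_diag /= !big_cons !big_nil mulg1.
Qed.

Lemma genV s : (gen s)^-1%g = gen s.
Proof. by apply/esym/(mulIg (gen s)); rewrite mulVg genM. Qed.

Lemma genK s w : (gen s * (gen s * w))%g = w.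
Proof. by rewrite mulgA genM mul1g. Qed.

Lemma gen_mulK s w : (w * gen s * gen s)%g = w.
Proof. by rewrite -mulgA genM mulg1. Qed.

Lemma wp_rev a : wp (rev a) = (wp a)^-1%g.
Proof.
elim: a => [|s a IH]; first by rewrite wp0 invg1.
by rewrite rev_cons wp_rcons wp_cons IH invgM genV.
Qed.

Lemma len_le a : (len (wp a) <= size a)%N.
Proof.
rewrite /cox_length; case: ex_minnP => n _; apply.
by apply/existsP; exists (in_tuple a); apply/eqP.
Qed.

Lemma lenP w : exists2 a, size a = len w & wp a = w.
Proof.
rewrite /cox_length; case: ex_minnP => n /existsP[a /eqP aw] _.
by exists a => //; rewrite size_tuple.
Qed.

Lemma len1 : len 1%g = 0%N.
Proof. by apply/eqP; rewrite -leqn0 -wp0; apply: len_le. Qed.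

Lemma len_eq0 w : (len w == 0%N) = (w == 1%g).
Proof.
apply/eqP/eqP => [l0|->]; last exact: len1.
by have [a sa <-] := lenP w; rewrite l0 in sa; rewrite (size0nil sa) wp0.
Qed.

Lemma lenM u v : (len (u * v) <= len u + len v)%N.
Proof.
have [a <- <-] := lenP u; have [b <- <-] := lenP v.
by rewrite -wp_cat -size_cat len_le.
Qed.

Lemma lenV u : len u^-1%g = len u.
Proof.
suff le v : (len v^-1%g <= len v)%N.
  by apply/eqP; rewrite eqn_leq le -{1}[u]invgK le.
by have [a <- <-] := lenP v; rewrite -wp_rev -(size_rev a) len_le.
Qed.

Lemma len_gen s : (len (gen s) <= 1)%N.
Proof. by rewrite -wp1; apply: len_le. Qed.

Lemma len_mul_ge u a : (len u <= len (u * wp a) + size a)%N.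
Proof.
rewrite -{1}[u](mulgK (wp a)) (leq_trans (lenM _ _)) // leq_add2l lenV.
exact: len_le.
Qed.

Lemma len_mulr_ge w s : (len w <= (len (w * gen s)).+1)%N.
Proof. by have := len_mul_ge w [:: s]; rewrite wp1 addn1. Qed.

Lemma len_mulr_le w s : (len (w * gen s) <= (len w).+1)%N.
Proof. by rewrite (leq_trans (lenM _ _)) // -addn1 leq_add2l len_gen. Qed.

Lemma len_last w : w != 1%g -> exists t, (len (w * gen t) < len w)%N.
Proof.
rewrite -len_eq0; have [a sa aw] := lenP w; rewrite -sa.
case/lastP: a => [//|a t] in sa aw *; move=> _; exists t.
rewrite -aw wp_rcons gen_mulK size_rcons ltnS; exact: len_le.
Qed.

Lemma weak_le_trans v u w : u <=w v -> v <=w w -> u <=w w.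
Proof.
rewrite /weak_le => /eqP uv /eqP vw; rewrite eqn_leq.
have := lenM u (u^-1 * w)%g; rewrite mulVKg => ->.
have -> : (u^-1 * w = u^-1 * v * (v^-1 * w))%g by rewrite -mulgA mulVKg.
by rewrite -vw -uv -addnA leq_add2l lenM.
Qed.

Lemma weak_le_refl w : w <=w w.
Proof. by rewrite /weak_le mulVg len1 addn0. Qed.

Lemma weak_le_anti u w : u <=w w -> w <=w u -> u = w.
Proof.
rewrite /weak_le => /eqP uw /eqP wu.
have /eqP : len (u^-1 * w)%g = 0%N by lia.
by rewrite len_eq0 => /eqP e; rewrite -[u]mulg1 -e mulVKg.
Qed.

Lemma weak_le_len u w : u <=w w -> (len u <= len w)%N.
Proof. by move=> /eqP <-; apply: leq_addr. Qed.

Lemma weak_le1 w : 1%g <=w w.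
Proof. by rewrite /weak_le len1 invg1 mul1g. Qed.

Fixpoint alt s t n : seq S := if n is n1.+1 then s :: alt t s n1 else [::].

Lemma size_alt s t n : size (alt s t n) = n.
Proof. by elim: n s t => //= n IH s t; rewrite IH. Qed.

Lemma alt_rcons s t n :
  alt s t n.+1 = rcons (alt s t n) (if odd n then t else s).
Proof.
elim: n s t => //= n IH s t; congr (_ :: _).
by apply: etrans (IH t s) _; case: (odd n).
Qed.

Lemma alt_cat s t i j : exists2 b, alt s t (i + j) = alt s t i ++ b & size b = j.
Proof.
elim: i s t => [|i IH] s t /=; first by exists (alt s t j); rewrite ?size_alt.
by have [b -> sb] := IH t s; exists b.
Qed.

(** The last k letters of (st)^k, a word with 2k letters, cancel against [alt t s k]. At k = m(s,t)
    this turns the relator into the braid relation. *)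
Lemma wp_alt s t k : wp (alt s t k) = ((gen s * gen t) ^+ k * wp (alt t s k))%g.
Proof.
elim: k s t => [|k IH] s t /=; first by rewrite expg0 mul1g.
have e j : (gen s * (gen t * gen s) ^+ j = (gen s * gen t) ^+ j * gen s)%g.
  elim: j => [|j IHj]; first by rewrite !expg0 mul1g mulg1.
  by rewrite !expgSr mulgA IHj -!mulgA.
by rewrite !wp_cons IH mulgA e expgSr -!mulgA genK.
Qed.

Lemma gen_expg s t : ((gen s * gen t) ^+ cox_mat C s t)%g = 1%g.
Proof.
have /(cox_presented C) := coxeter_cong_rel (cox_mat C) [::] [::] s t.
rewrite /= cats0 big_nil => <-.
elim: (cox_mat C s t) => [|k IH]; first by rewrite big_nil.
by rewrite expgS IH /= !big_cons mulgA.
Qed.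

Lemma wp_alt_braid s t :
  wp (alt s t (cox_mat C s t)) = wp (alt t s (cox_mat C s t)).
Proof. by rewrite wp_alt gen_expg mul1g. Qed.

End Length.

(** * The geometric representation *)

Section Representation.

Variables (W : groupType) (S : finType) (C : coxeterSystem W S).
Implicit Types (s t : S) (a b : seq S) (u v w : W).

Local Notation R := cfield.
Local Notation V := {ffun S -> R^o}.
Implicit Types x y : V.

Definition kappa s t : R := kap R (cox_mat C s t).

(** Twice the usual Tits form: roots get square norm 2, so that reflections need no division. *)
Definition cartan s t : R := if s == t then 2 else - kappa s t.

Definition al s : V := [ffun t => (t == s)%:R].

Definition pr s x : R := \sum_t cartan s t * x t.

Definition refl s x : V := x - pr s x *: al s.

Definition bil x y : R := \sum_s x s * pr s y.

(** The action is first defined on words; [act_cong] lets it descend to the group. *)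
Definition act a x : V := foldr refl x a.

Lemma kappaC s t : kappa s t = kappa t s.
Proof. by rewrite /kappa cox_mat_sym. Qed.

Lemma kappa_ge0 s t : s != t -> 0 <= kappa s t.
Proof. by move=> st; apply: kap_ge0; apply: cox_mat_offdiag. Qed.

Lemma kappa_ge1 s t : diagram_edge C s t -> 1 <= kappa s t.
Proof.
case/andP=> st nc; apply: kap_ge1; first exact: cox_mat_offdiag.
apply: contraNneq nc => m2; have := gen_expg C s t.
rewrite m2 expg2 => /eqP; rewrite mulg_eq1 invgM !genV => /eqP -> //.
Qed.

Lemma cartanC s t : cartan s t = cartan t s.
Proof. by rewrite /cartan eq_sym kappaC. Qed.

Lemma cartan_id s : cartan s s = 2. Proof. by rewrite /cartan eqxx. Qed.

Lemma cartanN s t : s != t -> cartan s t = - kappa s t.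
Proof. by rewrite /cartan => /negPf ->. Qed.

Lemma al_id s : al s s = 1. Proof. by rewrite ffunE eqxx. Qed.

Lemma al_neq s t : t != s -> al s t = 0.
Proof. by rewrite ffunE => /negPf ->. Qed.

Lemma scaleV (c : R) x s : (c *: x) s = c * x s.
Proof. by rewrite ffunE. Qed.

Lemma prD s x y : pr s (x + y) = pr s x + pr s y.
Proof. by rewrite -big_split; apply: eq_bigr => t _; rewrite ffunE mulrDr. Qed.

Lemma prZ s (c : R) x : pr s (c *: x) = c * pr s x.
Proof. by rewrite mulr_sumr; apply: eq_bigr => t _; rewrite ffunE mulrCA. Qed.

Lemma prN s x : pr s (- x) = - pr s x.
Proof. by rewrite -scaleN1r prZ mulN1r. Qed.

Lemma pr_al s t : pr s (al t) = cartan s t.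
Proof.
rewrite /pr (bigD1 t) //= al_id mulr1 big1 ?addr0 // => u ut.
by rewrite al_neq // mulr0.
Qed.

Lemma vec_sum x : x = \sum_s x s *: al s.
Proof.
apply/ffunP => t; rewrite sum_ffunE (bigD1 t) //= scaleV al_id mulr1.
by rewrite big1 ?addr0 // => u ut; rewrite scaleV al_neq ?mulr0 // eq_sym.
Qed.

Lemma reflD s x y : refl s (x + y) = refl s x + refl s y.
Proof. by rewrite /refl prD scalerDl opprD addrACA. Qed.

Lemma reflZ s (c : R) x : refl s (c *: x) = c *: refl s x.
Proof. by rewrite /refl prZ scalerBr scalerA. Qed.

Lemma reflE s x t : refl s x t = x t - pr s x * (t == s)%:R.
Proof. by rewrite !ffunE. Qed.

Lemma refl_neq s x t : t != s -> refl s x t = x t.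
Proof. by rewrite reflE => /negPf ->; rewrite mulr0 subr0. Qed.

Lemma refl_id s x : refl s x s = x s - pr s x.
Proof. by rewrite reflE eqxx mulr1. Qed.

Lemma pr_refl s x : pr s (refl s x) = - pr s x.
Proof. by rewrite /refl prD prN prZ pr_al cartan_id; ring. Qed.

Lemma reflK s : involutive (refl s).
Proof. by move=> x; rewrite {1}/refl pr_refl scaleNr opprK subrK. Qed.

Lemma refl_al s : refl s (al s) = - al s.
Proof.
rewrite /refl pr_al cartan_id -{1}[al s]scale1r -scalerBl -scaleN1r.
by congr (_ *: _); ring.
Qed.

Lemma refl_al_neq s t : s != t -> refl s (al t) = al t + kappa s t *: al s.
Proof. by move=> st; rewrite /refl pr_al cartanN // scaleNr opprK. Qed.

Lemma actD a x y : act a (x + y) = act a x + act a y.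
Proof. by elim: a => //= s a ->; rewrite reflD. Qed.

Lemma actZ a (c : R) x : act a (c *: x) = c *: act a x.
Proof. by elim: a => //= s a ->; rewrite reflZ. Qed.

Lemma act_cat a b x : act (a ++ b) x = act a (act b x).
Proof. exact: foldr_cat. Qed.

(* Chebyshev numbers [p_j] describe the powers of a product of two simple
   reflections; the induction uses [p_(j+1)^2 - k p_j p_(j+1) + p_j^2 = 1]. *)
Lemma act_pow s t j x : s != t ->
  let p := cheb (kappa s t) in
  act (flatten (nseq j [:: s; t])) x =
  x - (pr s x * p j ^+ 2 + pr t x * (p j * p j.+1)) *: al s
    - (pr t x * p j ^+ 2 + pr s x * ((kappa s t * p j - p j.+1) * p j)) *: al t.
Proof.
move=> st p.
have pI i : p i.+1 ^+ 2 - kappa s t * p i * p i.+1 + p i ^+ 2 = 1.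
  elim: i => [|i IH]; first by rewrite /p /=; ring.
  by rewrite -IH /p chebSS -/p; ring.
elim: j => [|j IH].
  by rewrite /p /= !(mul0r, mulr0, expr0n, addr0, scale0r, subr0).
rewrite [LHS]/= -/(act (flatten (nseq j [:: s; t])) x) IH.
set k := kappa s t in pI *; set A := pr s x; set B := pr t x.
set X := A * _ + _; set Y := B * _ + A * _.
have ts : t != s by rewrite eq_sym.
have prx' (c d : R) (u : S) :
    pr u (x - c *: al s - d *: al t) = pr u x - c * cartan u s - d * cartan u t.
  by rewrite !prD !prN !prZ !pr_al.
have vE (c d e : R) : x - c *: al s - d *: al t - e *: al t =
                      x - c *: al s - (d + e) *: al t.
  by rewrite scalerDl opprD addrA.
have vE' (c d e : R) : x - c *: al s - d *: al t - e *: al s =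
                      x - (c + e) *: al s - d *: al t.
  by rewrite [LHS]addrAC scalerDl opprD addrA.
rewrite {2}/refl prx' -/B cartan_id cartanN // kappaC -/k vE.
rewrite /refl prx' -/A cartan_id cartanN // -/k vE'.
have pS : p j.+2 = k * p j.+1 - p j by [].
have I0 : 1 - (p j.+1 ^+ 2 - k * p j * p j.+1 + p j ^+ 2) = 0.
  by rewrite pI subrr.
(* In each coordinate the two sides differ by a multiple of the vanishing quantity of [I0], which is
   added before [ring]. *)
congr (_ - _ *: _ - _ *: _); rewrite pS -[RHS]addr0.
  by rewrite -[X in _ = _ + X](mulr0 (A + k * B)) -I0 /X /Y; ring.
by rewrite -[X in _ = _ + X](mulr0 B) -I0 /X /Y; ring.
Qed.

End Representation.

(** * The action of the group, and positivity of roots versus length *)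

Section Roots.

Variables (W : groupType) (S : finType) (C : coxeterSystem W S).
Implicit Types (s t : S) (a b : seq S) (u v w : W).

Local Notation R := cfield.
Local Notation gen := (cox_gen C).
Local Notation wp := (word_prod C).
Local Notation len := (cox_length C).
Local Notation V := {ffun S -> R^o}.
Local Notation kappa := (kappa C).
Local Notation refl := (@refl W S C).
Local Notation act := (@act W S C).
Local Notation al := (@al S).
Implicit Types x y : V.

(** For finite m = m(s,t), every correction term in [act_pow] at j = m contains the factor p_m,
    which vanishes for k = 2 cos (pi/m). *)
Lemma act_cong a b : coxeter_cong (cox_mat C) a b -> act a =1 act b.
Proof.
elim=> {a b} [a x|a b _ IH x|a b c _ IH1 _ IH2 x|a b s t x] //.
  by rewrite IH1 IH2.
rewrite !act_cat; congr (act a _); move: (act b x) => {a b}x.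
have [<-|st] := eqVneq s t; first by rewrite cox_mat_diag /= !reflK.
have [-> //|m0] := eqVneq (cox_mat C s t) 0%N.
rewrite act_pow // /kappa cheb_kap_eq0 ?cox_mat_offdiag //.
by rewrite expr0n /= !(mul0r, mulr0, addr0) !scale0r !subr0.
Qed.

Definition rep w x : V := act (sval (cid (cox_generated C w))) x.

Lemma rep_wp a x : rep (wp a) x = act a x.
Proof.
rewrite /rep; case: cid => b /= ba; apply: act_cong.
exact/(cox_presented C).
Qed.

Lemma repM u v x : rep (u * v)%g x = rep u (rep v x).
Proof.
have [a _ <-] := lenP C u; have [b _ <-] := lenP C v.
by rewrite -wp_cat !rep_wp act_cat.
Qed.

Lemma rep1 x : rep 1%g x = x.
Proof. by rewrite -(wp0 C) rep_wp. Qed.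

Lemma rep_gen s x : rep (gen s) x = refl s x.
Proof. by rewrite -wp1 rep_wp. Qed.

Lemma repD w x y : rep w (x + y) = rep w x + rep w y.
Proof. exact: actD. Qed.

Lemma repZ w (c : R) x : rep w (c *: x) = c *: rep w x.
Proof. exact: actZ. Qed.

Lemma repN w x : rep w (- x) = - rep w x.
Proof. by rewrite -scaleN1r repZ scaleN1r. Qed.

Lemma rep0 w : rep w 0 = 0.
Proof. by rewrite -[in LHS](scale0r (0 : V)) repZ scale0r. Qed.

Lemma repK w x : rep w^-1 (rep w x) = x.
Proof. by rewrite -repM mulVg rep1. Qed.

Lemma repVK w x : rep w (rep w^-1 x) = x.
Proof. by rewrite -repM mulgV rep1. Qed.

Lemma rep_sum w x : rep w x = \sum_t x t *: rep w (al t).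
Proof.
rewrite {1}[x]vec_sum (big_morph _ (repD w) (rep0 w)).
by apply: eq_bigr => t _; rewrite repZ.
Qed.

Definition pos x := forall t, 0 <= x t.

Lemma posD x y : pos x -> pos y -> pos (x + y).
Proof. by move=> px py t; rewrite ffunE addr_ge0. Qed.

Lemma posZ (c : R) x : 0 <= c -> pos x -> pos (c *: x).
Proof. by move=> c0 px t; rewrite ffunE mulr_ge0. Qed.

Lemma pos_al s : pos (al s).
Proof. by move=> t; rewrite ffunE ler0n. Qed.

Lemma pos_anti x : pos x -> pos (- x) -> x = 0.
Proof.
move=> px nx; apply/ffunP => t; apply/le_anti; rewrite ffunE px andbT.
by have := nx t; rewrite ffunE oppr_ge0.
Qed.

Lemma al_neq0 s : al s != 0.
Proof.
by apply/eqP => /ffunP /(_ s); rewrite al_id ffunE => /eqP; rewrite oner_eq0.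
Qed.

Lemma rep_neq0 w x : x != 0 -> rep w x != 0.
Proof. by apply: contra => /eqP x0; rewrite -[x](repK w) x0 rep0. Qed.

(** In the plane of two simple roots, one reflection raises both Chebyshev indices by one and
    exchanges the roles of the two roots. *)
Lemma act_alt s t n i : s != t ->
  exists x y : S, [/\ act (rev (alt t s n))
      (cheb (kappa s t) i.+1 *: al s + cheb (kappa s t) i *: al t) =
    cheb (kappa s t) (n + i).+1 *: al x + cheb (kappa s t) (n + i) *: al y,
    x \in [:: s; t] & y \in [:: s; t]].
Proof.
elim: n s t i => [|n IH] s t i st.
  by exists s, t; rewrite !inE !eqxx orbT.
have ts : t != s by rewrite eq_sym.
have [x [y [e xst yst]]] := IH t s i.+1 ts.
exists x, y; rewrite addSnnS (kappaC _ s t) -e; split.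
- rewrite /= rev_cons -cats1 act_cat /=; congr (act _ _).
  rewrite reflD !reflZ refl_al refl_al_neq // scalerDr -addrA addrC.
  congr (_ + _); rewrite scalerA scalerN -scalerBl.
  by rewrite mulrC.
- by move: xst; rewrite !inE orbC.
- by move: yst; rewrite !inE orbC.
Qed.

(** The basic theorem on roots. For a right descent [t] of [w], strip from the right end of [w] the
    longest possible alternating word in [t] and [s]. The remainder [v] has neither letter as a
    right descent, so by induction it makes both simple roots positive. The stripped part sends
    [al s] to a combination of these two with Chebyshev coefficients, nonnegative because fewer than
    m(s,t) letters are stripped. *)
Lemma len_mulr_pos w s :
  (len w <= len (w * gen s))%N -> pos (rep w (al s)).
Proof.
have [n] := ubnP (len w); elim: n w s => // n IH w s /ltnSE-lw ws.
have [->|w1] := eqVneq w 1%g; first by rewrite rep1; apply: pos_al.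
have [t wt] := len_last C w1.
have st : s != t by apply: contraTneq wt => <-; rewrite -leqNgt.
pose P k := (len (w * wp (alt t s k)) + k == len w)%N.
have P1 : P 1%N.
  rewrite /P /= wp1 addn1 eqn_leq wt; exact: len_mulr_ge.
have Pb k : P k -> (k <= len w)%N by move=> /eqP <-; apply: leq_addl.
case: (ex_maxnP (ex_intro _ 1%N P1) Pb) => k Pk kmax.
have k1 : (0 < k)%N by apply: kmax.
set m := cox_mat C s t.
have km : (m == 0)%N || (k < m)%N.
  (* Had m letters been stripped, the braid relation would allow starting with [s], and [s] would
     shorten [w]. *)
  have [//|m0] := eqVneq m 0%N; rewrite /= ltnNge; apply/negP => mk.
  have [b e sb] := alt_cat t s m (k - m); rewrite subnKC // in e.
  have := len_mul_ge C (w * wp (alt t s m)) b.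
  rewrite -mulgA -wp_cat -e sb.
  have -> : wp (alt t s m) = wp (alt s t m).
    by rewrite /m cox_mat_sym wp_alt_braid.
  have := Pk; rewrite /P; case: (m) m0 mk => // m1 _ mk /=.
  rewrite wp_cons mulgA => /eqP Pk'.
  have := len_mul_ge C (w * gen s) (alt t s m1); rewrite size_alt => h1 h2.
  have h3 := leq_trans ws h1; have h4 := leq_add (leqnn m1) h2; move: h3 h4.
  by rewrite -Pk'; set A := len _; set B := len _; lia.
set v := (w * wp (alt t s k))%g in Pk *.
have lv : (len v + k = len w)%N by apply/eqP.
have wE : w = (v * wp (rev (alt t s k)))%g by rewrite wp_rev mulgK.
have vpos r : r \in [:: s; t] -> pos (rep v (al r)).
  move=> rst; apply: IH.
    by rewrite (leq_trans _ lw) // -lv -[X in (X < _)%N]addn0 ltn_add2l.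
  (* [vx] treats the letter stripped last, which leads back up towards [w]; [vy] treats the other
     letter, by maximality of [k]. *)
  have vx q : k = q.+1 ->
      (len v <= len (v * gen (if odd q then s else t)))%N.
    move=> kq; rewrite {2}/v kq alt_rcons wp_rcons mulgA gen_mulK.
    have := len_mul_ge C w (alt t s q); rewrite size_alt -lv kq.
    by rewrite addnS -addSn leq_add2r => /ltnW; rewrite /v kq alt_rcons.
  have vy : (len v <= len (v * gen (if odd k then s else t)))%N.
    rewrite leqNgt; apply/negP => vy.
    have := kmax k.+1; rewrite ltnn => /(_ _)/negP; apply => //.
    have -> : P k.+1 => //.
    rewrite /P alt_rcons wp_rcons mulgA -/v -lv addnS -addSn eqn_add2r.
    by rewrite eqn_leq vy len_mulr_ge.
  move: k1 vx vy; case: (k) => // q _ /(_ q erefl).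
  by move: rst; rewrite !inE /= => /orP[]/eqP->; case: (odd q).
have [x [y [e xst yst]]] := act_alt k 0 st.
rewrite wE repM rep_wp.
have -> : al s = cheb (kappa s t) 1 *: al s + cheb (kappa s t) 0 *: al t.
  by rewrite /= scale1r scale0r addr0.
rewrite e addn0 repD !repZ; have m1 := cox_mat_offdiag C st.
apply: posD; apply: posZ; try exact: vpos.
  by apply: cheb_kap_ge0.
by apply: cheb_kap_ge0 => //; case/orP: km => [->//|/ltnW]; rewrite orbC => ->.
Qed.

Lemma len_mulr_neg w s :
  (len (w * gen s) < len w)%N -> pos (- rep w (al s)).
Proof.
move=> ws; have := @len_mulr_pos (w * gen s)%g s.
rewrite gen_mulK => /(_ (ltnW ws)).
by rewrite repM rep_gen refl_al repN.
Qed.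

Lemma len_mulr_ltP w s :
  (len (w * gen s) < len w)%N <-> pos (- rep w (al s)).
Proof.
split; first exact: len_mulr_neg.
move=> neg; rewrite ltnNge; apply/negP => /len_mulr_pos p.
by have /eqP := pos_anti p neg; apply/negP/rep_neq0/al_neq0.
Qed.

Lemma len_mulr_leP w s : (len w <= len (w * gen s))%N <-> pos (rep w (al s)).
Proof.
split; first exact: len_mulr_pos.
move=> p; rewrite leqNgt; apply/negP => /len_mulr_neg neg.
by have /eqP := pos_anti p neg; apply/negP/rep_neq0/al_neq0.
Qed.

Lemma rep_al_dich w s : pos (rep w (al s)) \/ pos (- rep w (al s)).
Proof.
by have [/len_mulr_pos|/len_mulr_neg] := leqP (len w) (len (w * gen s));
  [left|right].
Qed.

(** Equal lengths would make a nonzero vector and its negative both positive. *)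
Lemma len_mulr w s :
  len (w * gen s) = (len w).+1 \/ len w = (len (w * gen s)).+1.
Proof.
have [lt|gt|eq] := ltngtP (len w) (len (w * gen s)).
- by left; apply/eqP; rewrite eqn_leq lt len_mulr_le.
- by right; apply/eqP; rewrite eqn_leq gt len_mulr_ge.
have p : pos (rep w (al s)) by apply: len_mulr_pos; rewrite eq.
have : pos (rep (w * gen s) (al s)) by apply: len_mulr_pos; rewrite gen_mulK eq.
rewrite repM rep_gen refl_al repN => /(pos_anti p)/eqP.
by rewrite (negPf (rep_neq0 _ (al_neq0 _))).
Qed.

End Roots.

Section Descents.

Variables (W : groupType) (S : finType) (C : coxeterSystem W S).
Implicit Types (s t : S) (a b : seq S) (u v w : W).

Local Notation gen := (cox_gen C).
Local Notation len := (cox_length C).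

Definition desc s w : bool := (len (gen s * w) < len w)%N.

Lemma len_genV s w : len (w^-1 * gen s)%g = len (gen s * w)%g.
Proof. by rewrite -lenV invgM invgK genV. Qed.

End Descents.

(** * Descents, the invariant form, inversions and standard parabolic subgroups *)

Section Inversions.

Variables (W : groupType) (S : finType) (C : coxeterSystem W S).
Implicit Types (s t : S) (a b : seq S) (u v w : W).

Local Notation R := cfield.
Local Notation gen := (cox_gen C).
Local Notation wp := (word_prod C).
Local Notation len := (cox_length C).
Local Notation "u <=w v" := (weak_le C u v) (at level 70).
Local Notation V := {ffun S -> R^o}.
Local Notation refl := (@refl W S C).
Local Notation pr := (@pr W S C).
Local Notation bil := (@bil W S C).
Local Notation al := (@al S).
Local Notation rep := (@rep W S C).
Local Notation desc := (desc C).
Implicit Types x y : V.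

Lemma descP s w : desc s w <-> pos (- rep w^-1 (al s)).
Proof. by rewrite -len_mulr_ltP lenV len_genV. Qed.

Lemma descN s w : ~~ desc s w <-> pos (rep w^-1 (al s)).
Proof. by rewrite -len_mulr_leP lenV len_genV -leqNgt. Qed.

Lemma len_desc s w : desc s w -> len w = (len (gen s * w)).+1.
Proof.
have := len_mulr C w^-1%g s.
by rewrite lenV len_genV /desc => -[->|-> //]; rewrite ltnNge leqnSn.
Qed.

Lemma len_ndesc s w : ~~ desc s w -> len (gen s * w)%g = (len w).+1.
Proof.
have := len_mulr C w^-1%g s.
by rewrite lenV len_genV /desc => -[-> //|->]; rewrite ltnSn.
Qed.

Lemma desc_gen s w : desc s (gen s * w) = ~~ desc s w.
Proof.
have [sw|sw] /= := boolP (desc s w); rewrite /desc genK.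
  by apply/negbTE; rewrite -leqNgt (len_desc sw) leqnSn.
by rewrite (len_ndesc sw) ltnSn.
Qed.

Lemma desc1 s : ~~ desc s 1%g.
Proof. by rewrite /desc len1 ltn0. Qed.

Lemma ex_desc w : w != 1%g -> exists s, desc s w.
Proof.
move=> w1; have /(len_last C)[s] : w^-1%g != 1%g by rewrite invg_eq1.
by rewrite lenV len_genV => ws; exists s.
Qed.

Lemma descent_ind (P : W -> Prop) : P 1%g ->
  (forall s w, ~~ desc s w -> P w -> P (gen s * w)%g) -> forall w, P w.
Proof.
move=> P1 PS w; have [n] := ubnP (len w); elim: n w => // n IH w /ltnSE lw.
have [-> //|/ex_desc[s sw]] := eqVneq w 1%g.
rewrite -(genK C s w); apply: PS; first by rewrite desc_gen sw.
by apply: IH; rewrite (leq_trans _ lw).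
Qed.

Lemma weak_le_desc s u w : u <=w w -> desc s u -> desc s w.
Proof.
move=> uw su; have := lenM C (gen s * u) (u^-1 * w).
rewrite -mulgA mulVKg /desc => /leq_ltn_trans; apply.
by rewrite -(eqP uw) ltn_add2r.
Qed.

Lemma weak_le_gen s u w : desc s u -> desc s w ->
  (gen s * u <=w gen s * w) = (u <=w w).
Proof.
move=> su sw; rewrite /weak_le invgM genV -mulgA genK.
by rewrite (len_desc su) (len_desc sw) addSn eqSS.
Qed.

Lemma weak_le_genl s u w : ~~ desc s u -> desc s w ->
  (gen s * u <=w w) = (u <=w gen s * w).
Proof. by move=> su sw; rewrite -(weak_le_gen (s := s)) ?desc_gen ?genK. Qed.

Lemma faithful w : (forall x, rep w x = x) -> w = 1%g.
Proof.
move=> wx; apply/eqP; apply: contraT => /(len_last C)[s].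
move=> /len_mulr_neg; rewrite wx => n.
by have /eqP := pos_anti (pos_al s) n; rewrite (negPf (al_neq0 s)).
Qed.

Lemma bilC x y : bil x y = bil y x.
Proof.
rewrite /bil; under eq_bigr do rewrite mulr_sumr.
under [RHS]eq_bigr do rewrite mulr_sumr.
rewrite exchange_big; apply: eq_bigr => s _; apply: eq_bigr => t _ /=.
by rewrite cartanC; ring.
Qed.

Lemma bil_al s x : bil (al s) x = pr s x.
Proof.
rewrite /bil (bigD1 s) //= al_id mul1r big1 ?addr0 // => t ts.
by rewrite al_neq ?mul0r.
Qed.

Lemma bilD x y z : bil x (y + z) = bil x y + bil x z.
Proof. by rewrite /bil -big_split; apply: eq_bigr => s _; rewrite prD mulrDr. Qed.

Lemma bilZ x (c : R) y : bil x (c *: y) = c * bil x y.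
Proof. by rewrite /bil mulr_sumr; apply: eq_bigr => s _; rewrite prZ mulrCA. Qed.

Lemma bil_refl s x y : bil (refl s x) (refl s y) = bil x y.
Proof.
have bilDl (z1 z2 z3 : V) : bil (z1 + z2) z3 = bil z1 z3 + bil z2 z3.
  by rewrite bilC bilD ![bil z3 _]bilC.
have bilZl (c : R) (z1 z2 : V) : bil (c *: z1) z2 = c * bil z1 z2.
  by rewrite bilC bilZ bilC.
rewrite /refl -!scaleNr !(bilDl, bilZl, bilD, bilZ) [bil x (al s)]bilC !bil_al.
by rewrite pr_al cartan_id; ring.
Qed.

Lemma bil_rep w x y : bil (rep w x) (rep w y) = bil x y.
Proof.
elim/descent_ind: w => [|s w _ IH]; first by rewrite !rep1.
by rewrite !repM !rep_gen bil_refl.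
Qed.

(** As [z] preserves [bil], it conjugates the reflection in [al q] to the one in the image root;
    faithfulness brings this back to the group. *)
Lemma gen_conj z q s : rep z (al q) = al s -> (gen s * z = z * gen q)%g.
Proof.
move=> e; suff : (gen s * (z * gen q * z^-1))%g = 1%g.
  by move/mulg1_eq; rewrite genV => ->; rewrite mulgVK.
apply: faithful => x; rewrite !repM !rep_gen {2}/refl -scaleNr repD repZ repVK e.
have -> : pr q (rep z^-1 x) = pr s x.
  by rewrite -!bil_al -(bil_rep z) e repVK.
by rewrite scaleNr -/(refl s x) reflK.
Qed.

Definition is_root x := exists w s, x = rep w (al s).

Lemma root_al s : is_root (al s).
Proof. by exists 1%g, s; rewrite rep1. Qed.

Lemma root_rep w x : is_root x -> is_root (rep w x).
Proof. by case=> u [s ->]; exists (w * u)%g, s; rewrite repM. Qed.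

Lemma root_refl s x : is_root x -> is_root (refl s x).
Proof. by rewrite -rep_gen; apply: root_rep. Qed.

Lemma root_dich x : is_root x -> pos x \/ pos (- x).
Proof. by case=> u [s ->]; apply: rep_al_dich. Qed.

Lemma root_bil x : is_root x -> bil x x = 2.
Proof. by case=> u [s ->]; rewrite bil_rep bil_al pr_al cartan_id. Qed.

Lemma root_neq0 x : is_root x -> x != 0.
Proof. by case=> u [s ->]; rewrite rep_neq0 ?al_neq0. Qed.

Lemma root_anti x : is_root x -> pos x -> ~ pos (- x).
Proof.
by move=> /root_neq0 x0 px nx; rewrite (pos_anti px nx) eqxx in x0.
Qed.

(** Such a root is a nonnegative multiple of [al s], and the norm 2 forces the factor 1. *)
Lemma root_multiple x s : is_root x -> pos x ->
  (forall t, t != s -> x t = 0) -> x = al s.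
Proof.
move=> rx px x0; have xE : x = x s *: al s.
  apply/ffunP => t; rewrite scaleV; have [->|ts] := eqVneq t s.
    by rewrite al_id mulr1.
  by rewrite x0 // al_neq // mulr0.
have := root_bil rx; rewrite xE bilZ bilC bilZ bil_al pr_al cartan_id.
have := px s => xs0 e; have -> : x s = 1 by nra.
by rewrite scale1r.
Qed.

(** Only the coordinate at [s] changes. If the image were negative, all other coordinates of [x]
    would vanish. *)
Lemma refl_pos s x : is_root x -> pos x -> x != al s -> pos (refl s x).
Proof.
move=> rx px xs; have [//|n] := root_dich (root_refl s rx).
case/eqP: xs; apply: root_multiple => // t ts; apply/le_anti.
by have := n t; rewrite px ffunE refl_neq // oppr_ge0 => ->.
Qed.

Lemma refl_neg_al s x : is_root x -> pos x -> ~ pos (refl s x) -> x = al s.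
Proof.
by move=> rx px n; apply/eqP; apply/negP => /negP xs; apply/n/refl_pos.
Qed.

(* The positive roots of the inversions of [w]. *)
Definition inv_root w x := [/\ is_root x, pos x & pos (- rep w^-1 x)].

Lemma inv_root_al s w : desc s w -> inv_root w (al s).
Proof. by move=> /descP n; split=> //; [apply: root_al|apply: pos_al]. Qed.

Lemma inv_root_refl s w x : ~~ desc s w -> inv_root w x ->
  inv_root (gen s * w)%g (refl s x).
Proof.
move=> /descN sw [rx px nx]; split; first exact: root_refl.
  apply: refl_pos => //; apply/eqP => xs; rewrite {}xs in nx.
  by apply: root_anti sw nx; apply/root_rep/root_al.
by rewrite invgM genV repM rep_gen reflK.
Qed.

(** Parabolic subgroups described by words, which suits induction; [parabolicP] identifies them with
    the generated subgroups. *)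
Definition par (A : pred S) w := exists2 a, all A a & wp a = w.

Lemma par1 A : par A 1%g. Proof. by exists [::]; rewrite ?wp0. Qed.

Lemma par_wp (A : pred S) a : all A a -> par A (wp a).
Proof. by exists a. Qed.

Lemma par_gen (A : pred S) s : A s -> par A (gen s).
Proof. by move=> As; exists [:: s]; rewrite /= ?As ?wp1. Qed.

Lemma parM A u v : par A u -> par A v -> par A (u * v)%g.
Proof.
move=> [a Aa <-] [b Ab <-]; exists (a ++ b); last by rewrite wp_cat.
by rewrite all_cat Aa Ab.
Qed.

Lemma parV A u : par A u -> par A u^-1%g.
Proof. by case=> a Aa <-; exists (rev a); rewrite ?all_rev ?wp_rev. Qed.

Lemma par_sub (A B : pred S) u : subpred A B -> par A u -> par B u.
Proof. by move=> AB [a Aa <-]; exists a => //; apply: sub_all Aa. Qed.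

Lemma par_rep (A : pred S) w x t : par A w -> ~~ A t -> rep w x t = x t.
Proof.
case=> a Aa <-; rewrite rep_wp => At; elim: a Aa => //= s a IH /andP[As Aa].
by rewrite refl_neq ?IH //; apply: contraNneq At => ->.
Qed.

Lemma par_desc (A : pred S) w s : par A w -> desc s w -> A s.
Proof.
move=> Aw /descP /(_ s) n; apply: contraTT n => As.
by rewrite ffunE (par_rep _ (parV Aw) As) al_id oppr_ge0 ler10.
Qed.

Lemma par_inv_root (A : pred S) w x t : par A w -> inv_root w x -> ~~ A t ->
  x t = 0.
Proof.
move=> Aw [_ px nx] At; apply/le_anti; rewrite px andbT.
by have := nx t; rewrite ffunE (par_rep _ (parV Aw) At) oppr_ge0.
Qed.

End Inversions.

(** * Sorting along a word *)

Section ListSorting.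

Variables (W : groupType) (S : finType) (C : coxeterSystem W S).
Implicit Types (s t : S) (a b c : seq S) (u v w : W).

Local Notation R := cfield.
Local Notation gen := (cox_gen C).
Local Notation len := (cox_length C).
Local Notation "u <=w v" := (weak_le C u v) (at level 70).
Local Notation V := {ffun S -> R^o}.
Local Notation kappa := (kappa C).
Local Notation refl := (@refl W S C).
Local Notation pr := (@pr W S C).
Local Notation bil := (@bil W S C).
Local Notation al := (@al S).
Local Notation rep := (@rep W S C).
Local Notation desc := (desc C).
Local Notation inv_root := (inv_root C).
Implicit Types (x y : V) (L : seq V).

(* The projection to sortable elements for the Coxeter element with word [c].
   There is no need to replace [w] by its parabolic part when a letter is
   dropped, since only descents among the remaining letters are tested. *)
Inductive proj : seq S -> W -> W -> Prop :=
| proj_nil w : proj [::] w 1%g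
| proj_take s c w u : desc s w ->
    proj (rcons c s) (gen s * w)%g u -> proj (s :: c) w (gen s * u)%g
| proj_skip s c w u : ~~ desc s w -> proj c w u -> proj (s :: c) w u.

(* [skips c v L]: [v] is sortable for [c], and [L] lists the roots recorded when
   letters are dropped. *)
Inductive skips : seq S -> W -> seq V -> Prop :=
| skips_nil : skips [::] 1%g [::]
| skips_take s c v L : desc s v ->
    skips (rcons c s) (gen s * v)%g L -> skips (s :: c) v (map (refl s) L)
| skips_skip s c v L : ~~ desc s v -> skips c v L -> skips (s :: c) v (al s :: L).

Lemma proj_inv s c w u : proj (s :: c) w u ->
  if desc s w
  then exists2 u', u = (gen s * u')%g & proj (rcons c s) (gen s * w)%g u'
  else proj c w u.
Proof.
move=> p; inversion p as [|s' c' w' u' sw p'|s' c' w' u' sw p']; subst.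
  by rewrite sw; exists u'.
by rewrite (negPf sw).
Qed.

Lemma skips_inv s c v L : skips (s :: c) v L ->
  if desc s v then exists L', skips (rcons c s) (gen s * v)%g L'
  else exists L', skips c v L'.
Proof.
move=> p; inversion p as [|s' c' w' L' sw p'|s' c' w' L' sw p']; subst.
  by rewrite sw; exists L'.
by rewrite (negPf sw); exists L'.
Qed.

Lemma skips_nil_inv v L : skips [::] v L -> v = 1%g.
Proof. by move=> p; inversion p. Qed.

Lemma ex_proj c w : exists u, proj c w u.
Proof.
have [n] := ubnP (len w); elim: n c w => // n IHn c w /ltnSE lw.
elim: c => [|s c [u cu]]; first by exists 1%g; apply: proj_nil.
have [sw|sw] := boolP (desc s w); last by exists u; apply: proj_skip.
have [|u' pu] := IHn (rcons c s) (gen s * w)%g; first exact: leq_trans lw.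
by exists (gen s * u')%g; apply: proj_take.
Qed.

Lemma skips_par c v L : skips c v L -> par C [in c] v.
Proof.
elim=> {c v L} [|s c v L sv _ IH|s c v L _ _ IH]; first exact: par1.
  rewrite -(genK C s v); apply: parM; first by apply: par_gen; apply: mem_head.
  by apply: par_sub IH => t /=; rewrite mem_rcons.
by apply: par_sub IH => t /= tc; rewrite inE tc orbT.
Qed.

Lemma skips_root c v L x : skips c v L -> x \in L -> is_root C x.
Proof.
move=> sk; elim: sk x => {c v L} [|s c v L sv _ IH|s c v L _ _ IH] x //.
  by case/mapP => y yL ->; apply/root_refl/IH.
by rewrite inE => /orP[/eqP ->|/IH //]; apply: root_al.
Qed.

Definition supp (c : seq S) x := forall t, t \notin c -> x t = 0.

Lemma skips_supp c v L x : skips c v L -> x \in L -> supp c x.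
Proof.
move=> sk; elim: sk x => {c v L} [|s c v L sv _ IH|s c v L _ _ IH] x //.
  case/mapP => y yL -> t; rewrite inE negb_or => /andP[ts tc].
  by rewrite refl_neq //; apply: (IH _ yL); rewrite mem_rcons inE negb_or ts.
rewrite inE => /orP[/eqP -> t|/IH xL t]; rewrite inE negb_or => /andP[ts tc].
  exact: al_neq.
exact: xL.
Qed.

Lemma inv_root_supp c v x : par C [in c] v -> inv_root v x -> supp c x.
Proof. by move=> cv ix t tc; apply: par_inv_root cv ix _. Qed.

Lemma supp_rcons c s x : supp (s :: c) x -> supp (rcons c s) x.
Proof. by move=> sx t; rewrite mem_rcons; apply: sx. Qed.

Lemma supp_refl c s x : supp (s :: c) x -> supp (s :: c) (refl s x).
Proof.
move=> sx t tc; rewrite refl_neq; first exact: sx.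
by apply: contraNneq tc => ->; apply: mem_head.
Qed.

Lemma pr_supp s c x : uniq (s :: c) -> supp (s :: c) x ->
  pr s x = 2 * x s - \sum_(t <- c) kappa s t * x t.
Proof.
move=> uc sx; rewrite /pr (bigID (mem (s :: c))) /= [X in _ + X]big1 ?addr0.
  rewrite -(big_uniq _ uc) /= big_cons cartan_id; congr (_ + _).
  rewrite -sumrN; apply: eq_big_seq => t tc; rewrite cartanN ?mulNr //.
  by case/andP: uc => sc _; apply: contraNneq sc => ->.
by move=> t tc; rewrite sx ?mulr0.
Qed.

(* The Euler form of the Coxeter element with word [c]; its symmetrization is
   [bil], normalized by [bil x x = 2] on roots. *)
Fixpoint eform c x y : R :=
  if c is s :: c' then
    (x s - \sum_(t <- c') kappa s t * x t) * y s + eform c' x y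
  else 0.

Lemma eform_rcons c s x y :
  eform (rcons c s) x y =
  eform c x y + x s * (y s - \sum_(t <- c) kappa s t * y t).
Proof.
elim: c => [|r c IH] /=; first by rewrite !big_nil; ring.
by rewrite IH -cats1 big_cat big_seq1 big_cons /= (kappaC C r s); ring.
Qed.

Lemma eq_eform c x x' y y' : {in c, x =1 x'} -> {in c, y =1 y'} ->
  eform c x y = eform c x' y'.
Proof.
elim: c => //= s c IH xx yy.
have sub t : t \in c -> t \in s :: c by move=> tc; rewrite inE tc orbT.
rewrite IH => [|t /sub/xx|t /sub/yy] //.
rewrite xx ?mem_head // yy ?mem_head //; congr ((_ - _) * _ + _).
by apply: eq_big_seq => t /sub/xx ->.
Qed.

Lemma eform0l c x y : {in c, forall t, x t = 0} -> eform c x y = 0.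
Proof.
elim: c => //= s c IH x0.
have x0' : {in c, forall t, x t = 0} by move=> t tc; apply: x0; rewrite inE tc orbT.
rewrite IH // x0 ?mem_head // big1_seq ?subrr ?mul0r ?addr0 // => t /andP[_ tc].
by rewrite x0' ?mulr0.
Qed.

Lemma eform0r c x y : {in c, forall t, y t = 0} -> eform c x y = 0.
Proof.
elim: c => //= s c IH y0; rewrite y0 ?mem_head // mulr0 add0r IH // => t tc.
by apply: y0; rewrite inE tc orbT.
Qed.

Lemma al_notin c s : s \notin c -> {in c, forall t, al s t = 0}.
Proof. by move=> sc t tc; rewrite al_neq //; apply: contraNneq sc => <-. Qed.

(** Reflecting [x] makes its coordinate at [s] the negative of the old bracket x_s - sum, and
    reflecting [y] makes its new bracket the negative of the old y_s. The two signs cancel. This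
    invariance carries conditions on the Euler form through a step that takes a letter. *)
Lemma eform_refl s c x y : uniq (s :: c) -> supp (s :: c) x -> supp (s :: c) y ->
  eform (rcons c s) (refl s x) (refl s y) = eform (s :: c) x y.
Proof.
move=> uc sx sy; have sc : s \notin c by case/andP: uc.
have rE z : {in c, refl s z =1 z}.
  by move=> t tc; rewrite refl_neq //; apply: contraNneq sc => <-.
rewrite eform_rcons /= (eq_eform (rE x) (rE y)) !refl_id.
have -> : \sum_(t <- c) kappa s t * refl s y t = \sum_(t <- c) kappa s t * y t.
  by apply: eq_big_seq => t /rE ->.
by rewrite !(pr_supp uc) //; ring.
Qed.

Inductive cone L : V -> Prop :=
| cone0 : cone L 0
| cone_add (k : R) x y : 0 <= k -> x \in L -> cone L y -> cone L (k *: x + y).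

Lemma cone_refl s L x : cone L x -> cone (map (refl s) L) (refl s x).
Proof.
elim=> [|k y z k0 yL _ IH]; first by rewrite -rep_gen rep0; apply: cone0.
by rewrite reflD reflZ; apply: cone_add => //; apply: map_f.
Qed.

Lemma cone_cons L x y : cone L x -> cone (y :: L) x.
Proof.
elim=> [|k x1 x2 k0 xL _ IH]; first exact: cone0.
by apply: cone_add => //; rewrite inE xL orbT.
Qed.

Lemma cone_pos w L x : cone L x -> {in L, forall y, pos (rep w y)} ->
  pos (rep w x).
Proof.
move=> cx pL; elim: cx => [|k y z k0 /pL py _ IH].
  by rewrite rep0 => t; rewrite ffunE.
by rewrite repD repZ; apply: posD => //; apply: posZ.
Qed.

Lemma inv_root_genM s v x : desc s v -> inv_root (gen s * v)%g x ->
  inv_root v (refl s x).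
Proof.
move=> sv ix; rewrite -(genK C s v); apply: inv_root_refl => //.
by rewrite desc_gen sv.
Qed.

(** Induction on the procedure. When [s] is taken, the hypothesis at the inversion [al s] says
    precisely that the reflected [x] still has a nonnegative coordinate at [s]. When [s] is dropped,
    [al s] is recorded and its share of [x] can be subtracted: the inversions of [v] have no
    coordinate at [s], so the remaining inequalities are unaffected. *)
Lemma cone_skips c v L x : skips c v L -> uniq c -> pos x -> supp c x ->
  (forall y, inv_root v y -> eform c x y <= 0) -> cone L x.
Proof.
move=> sk; elim: sk x => {c v L} [|s c v L sv sk IH|s c v L sv sk IH] x uc px sx xy.
- have -> : x = 0 by apply/ffunP => t; rewrite ffunE sx.
  exact: cone0.
- have vc : par C [in s :: c] v by apply: skips_par (skips_take sv sk).
  have sc : s \notin c by case/andP: uc.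
  rewrite -[x](reflK C s); apply: cone_refl; apply: IH => [| | |y iy].
  + by rewrite rcons_uniq.
  + move=> t; have [->|ts] := eqVneq t s; last by rewrite refl_neq.
    rewrite refl_id; have := xy _ (inv_root_al sv).
    rewrite /= al_id mulr1 eform0r ?addr0; last exact: al_notin.
    rewrite (pr_supp uc sx); lra.
  + exact/supp_rcons/supp_refl.
  have iy' := inv_root_genM sv iy.
  have sy' := inv_root_supp vc iy'.
  by rewrite -[y](reflK C s) eform_refl //; apply: xy.
have /andP[sc uc'] := uc.
have -> : x = x s *: al s + (x - x s *: al s) by rewrite addrC subrK.
apply: cone_add; [exact: px|exact: mem_head|apply: cone_cons].
have x'V t : (x - x s *: al s) t = x t - x s * al s t by rewrite !ffunE.
have x'E t : t != s -> (x - x s *: al s) t = x t.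
  by move=> ts; rewrite x'V al_neq // mulr0 subr0.
have x's : (x - x s *: al s) s = 0 by rewrite x'V al_id mulr1 subrr.
apply: IH => // [t|t tc|y iy].
- by have [->|ts] := eqVneq t s; rewrite ?x's ?x'E.
- have [->|ts] := eqVneq t s; first exact: x's.
  by rewrite x'E // sx // inE negb_or ts.
have sy : supp c y := inv_root_supp (skips_par sk) iy.
apply: le_trans (xy y iy); rewrite /= sy // mulr0 add0r.
rewrite (@eq_eform c _ x y y) // => t tc; rewrite x'E //.
by apply: contraNneq sc => <-.
Qed.

(** Strip a left descent [r] of the element: [al r] is an inversion, hence orthogonal to [al s], so
    [r] fixes [al s] and the hypothesis passes to the remainder. *)
Lemma rep_fixed s v : (forall y, inv_root v y -> pr s y = 0) ->
  rep v^-1 (al s) = al s.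
Proof.
elim/(@descent_ind W S C): v => [|r v rv IH] y0; first by rewrite invg1 rep1.
have rs : refl r (al s) = al s.
  have /y0 : inv_root (gen r * v)%g (al r) by apply: inv_root_al; rewrite desc_gen.
  by rewrite /refl -!bil_al bilC => ->; rewrite scale0r subr0.
rewrite invgM genV repM rep_gen rs; apply: IH => y iy.
by rewrite -bil_al -(bil_refl C r) rs bil_al; apply/y0/inv_root_refl.
Qed.

Lemma sum_kappa_ge0 s c x : s \notin c -> pos x ->
  0 <= \sum_(t <- c) kappa s t * x t.
Proof.
move=> sc px; rewrite big_seq; apply: sumr_ge0 => t tc.
by rewrite mulr_ge0 ?kappa_ge0 //; apply: contraNneq sc => ->.
Qed.

(** Invariance carries the inequality to the moment when [x] is recorded as some [al s]. There the
    left side is 0 and the right side is minus a nonnegative sum, so every inversion of the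
    remainder is orthogonal to [al s], and [rep_fixed] applies. *)
Lemma simple_skips c v L x : skips c v L -> uniq c -> x \in L ->
  (forall y, inv_root v y -> eform c x y <= eform c y x) ->
  exists r, rep v^-1 x = al r.
Proof.
move=> sk; elim: sk x => {c v L} [|s c v L sv sk IH|s c v L sv sk IH] x //.
  move=> uc /mapP[x' x'L ->] xy.
  have vc : par C [in s :: c] v by apply: skips_par (skips_take sv sk).
  have sx' : supp (s :: c) (refl s x').
    by apply: skips_supp (skips_take sv sk) _; apply: map_f.
  have [|//|y iy|r rE] := IH x'; first by rewrite rcons_uniq.
    have iy' := inv_root_genM sv iy; have sy' := inv_root_supp vc iy'.
    by rewrite -[y](reflK C s) -[x'](reflK C s) !eform_refl //; apply: xy.
  by exists r; rewrite -rE invgM genV repM rep_gen.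
move=> uc; have /andP[sc uc'] := uc; rewrite inE => /orP[/eqP->|xL] xy.
  exists s; apply: rep_fixed => y iy.
  have sy : supp c y := inv_root_supp (skips_par sk) iy.
  have sy' : supp (s :: c) y.
    by move=> t; rewrite inE negb_or => /andP[_]; apply: sy.
  have [_ py _] := iy.
  have := xy y iy; rewrite /= al_id eform0l ?eform0r; try exact: al_notin.
  have := sum_kappa_ge0 sc py; rewrite (pr_supp uc sy') (sy s sc).
  set X := \sum_(t <- c) _; set Y := \sum_(t <- c) _; lra.
apply: IH => // y iy; have := xy y iy.
have sy : supp c y := inv_root_supp (skips_par sk) iy.
by rewrite /= sy // (skips_supp sk xL sc) !mulr0 !add0r.
Qed.

(** A letter is dropped only when it is not a descent of what is left of [w]; transported back, this
    says that the recorded roots of the projection are positive at [w]. *)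
Lemma proj_spec c w u : proj c w u -> u <=w w /\
  exists2 L, skips c u L & {in L, forall x, pos (rep w^-1 x)}.
Proof.
elim=> {c w u} [w|s c w u sw _ [uw [L sk pL]]|s c w u sw _ [uw [L sk pL]]].
- by split; [exact: weak_le1|exists [::] => //; exact: skips_nil].
- have su : ~~ desc s u.
    by apply/negP => /(weak_le_desc uw); rewrite desc_gen sw.
  split; first by rewrite weak_le_genl.
  exists (map (refl s) L); first by apply: skips_take; rewrite ?desc_gen ?genK.
  move=> _ /mapP[x /pL px ->].
  by move: px; rewrite invgM genV repM rep_gen.
have su : ~~ desc s u by apply: contra sw; apply: weak_le_desc.
split=> //; exists (al s :: L); first exact: skips_skip.
by move=> x; rewrite inE => /orP[/eqP ->|/pL //]; apply/descN.
Qed.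

(** When the new letter comes to the front, the remainder lies in the parabolic subgroup of the old
    letters, so the new one is not a descent and is dropped. *)
Lemma skips_insert c c1 c2 s v L : skips c v L -> c = c1 ++ c2 -> s \notin c ->
  exists L', skips (c1 ++ s :: c2) v L'.
Proof.
move=> sk; elim: sk c1 c2 => {c v L} [|r c v L rv sk IH|r c v L rv sk IH] c1 c2.
- case: c1 c2 => [|? ?] [|? ?] // _ _.
  by exists [:: al s]; apply/skips_skip/skips_nil/desc1.
- case: c1 => [/= <- sc|r1 c1 [<- cE] sc] /=.
    have sk' := skips_take rv sk.
    exists (al s :: map (refl r) L); apply: skips_skip => //.
    by apply: contra sc; apply: par_desc (skips_par sk').
  have [|| L' sk'] := IH c1 (rcons c2 r); first by rewrite cE rcons_cat.
    by rewrite mem_rcons.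
  by exists (map (refl r) L'); apply: skips_take => //; rewrite rcons_cat.
case: c1 => [/= <- sc|r1 c1 [<- cE] sc] /=.
  have sk' := skips_skip rv sk.
  exists (al s :: al r :: L); apply: skips_skip => //.
  by apply: contra sc; apply: par_desc (skips_par sk').
have [|| L' sk'] := IH c1 c2 => //.
  by apply: contra sc => sc; rewrite inE sc orbT.
by exists (al r :: L'); apply: skips_skip.
Qed.

(** Climb from [v] to [w] one generator at a time. At the step from [z] to [z * gen q] where [s]
    becomes a descent, the positive root z^-1 (al s) is made negative by [q], so it is [al q]. *)
Lemma weak_le_cross s v w : v <=w w -> desc s w -> ~~ desc s v ->
  exists z q, [/\ v <=w z, ~~ desc s z, rep z (al q) = al s & gen s * z <=w w].
Proof.
have [n] := ubnP (len (v^-1 * w)%g); elim: n v => // n IH v /ltnSE ln vw sw sv.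
have : (v^-1 * w)%g != 1%g.
  apply: contraNneq sv => e; suff -> : v = w by [].
  by rewrite -[w](mulVKg v) e mulg1.
move=> /(@ex_desc W S C)[q qy].
have lvw := eqP vw; have ly := len_desc qy.
have yE : ((v * gen q)^-1 * w = gen q * (v^-1 * w))%g.
  by rewrite invgM genV mulgA.
have l1 := lenM C (v * gen q) ((v * gen q)^-1 * w); rewrite mulVKg yE in l1.
have l2 := len_mulr_le C v q.
have l3 : len (v * gen q)%g = (len v).+1.
  apply/eqP; rewrite eqn_leq l2 /= -(leq_add2r (len (gen q * (v^-1 * w))%g)).
  by rewrite addSnnS -ly lvw.
have vvq : v <=w v * gen q.
  have := lenM C v (gen q); rewrite /weak_le mulKg l3.
  have := len_gen C q; case: (len (gen q)) => [|[|//]] _; last by rewrite addn1.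
  by rewrite addn0 ltnn.
have vqw : (v * gen q)%g <=w w.
  by rewrite /weak_le yE l3 addSnnS -ly lvw.
have [svq|svq] := boolP (desc s (v * gen q)).
  have vs : rep v^-1 (al s) = al q.
    apply: refl_neg_al; [exact/root_rep/root_al|exact/descN|].
    move/descP: svq; rewrite invgM genV repM rep_gen => n1 n2.
    by apply: root_anti n2 n1; apply/root_refl/root_rep/root_al.
  have vq : rep v (al q) = al s by rewrite -vs repVK.
  by exists v, q; split=> //; [exact: weak_le_refl|rewrite (gen_conj vq)].
have [|z [r [vz sz zr zw]]] := IH (v * gen q)%g _ vqw sw svq.
  by rewrite yE -ltnS -ly.
by exists z, r; split=> //; apply: weak_le_trans vz.
Qed.

Lemma weak_le_gen_conj s r v : ~~ desc s v -> rep v (al r) = al s ->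
  v <=w gen s * v.
Proof.
move=> sv /(@gen_conj W S C _ _ _) e; rewrite /weak_le e mulKg -e (len_ndesc sv).
have := lenM C v (gen r); rewrite -e (len_ndesc sv).
by have := len_gen C r; case: (len (gen r)) => [|[|//]] _;
  rewrite ?addn0 ?ltnn ?addn1.
Qed.

(** Induction on the length of [w], then on the word. If the first letter [s] is not a descent of
    [w] it is dropped, and if it is a descent of both [v] and [w] it is cancelled. The remaining
    case crosses the wall of [al s]. *)
Lemma proj_greatest c w u v L : uniq c -> proj c w u -> skips c v L ->
  v <=w w -> v <=w u.
Proof.
have [n] := ubnP (len w); elim: n c w u v L => // n IHn c w u v L /ltnSE lw.
elim: c u v L => [|s c IHc] u v L uc pu skv vw.
  by rewrite (skips_nil_inv skv); apply: weak_le1.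
have /andP[sc uc'] := uc; have uc1 : uniq (rcons c s) by rewrite rcons_uniq.
have := proj_inv pu; have := skips_inv skv.
have [sw|sw] := boolP (desc s w); last first.
  have sv : ~~ desc s v by apply: contra sw; apply: weak_le_desc.
  by rewrite (negPf sv) => -[L' skv'] pu'; apply: IHc skv' vw.
move=> skv1 [u' -> pu']; have lsw : (len (gen s * w)%g < n)%N by apply: leq_trans lw.
have [uw' _] := proj_spec pu'.
have su' : ~~ desc s u'.
  by apply/negP => /(weak_le_desc uw'); rewrite desc_gen sw.
have [sv|sv] := boolP (desc s v); move: skv1; rewrite ?sv ?(negPf sv).
  case=> L' skv'; rewrite -(genK C s v) weak_le_genl ?desc_gen ?sv // genK.
  by apply: IHn pu' skv' _ => //; rewrite weak_le_gen.
case=> L' skv'.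
have [z [q [vz sz zq szw]]] := weak_le_cross vw sw sv.
have lz : (len z < n)%N.
  by apply: leq_trans lw; rewrite -(len_ndesc sz) weak_le_len.
have [x px] := ex_proj (rcons c s) z.
have [xz [M skx pM]] := proj_spec px.
have sx : ~~ desc s x by apply: contra sz; apply: weak_le_desc.
(* As [s] does not occur in [c], sortability of [v] for [c] extends to [rcons c s], and [z] is
   shorter than [w]. *)
have vx : v <=w x.
  have [|L2 skv2] := @skips_insert c c [::] s v L' skv' _ sc; first by rewrite cats0.
  by rewrite cats1 in skv2; apply: IHn px skv2 vz.
have szx : gen s * x <=w gen s * z by rewrite weak_le_genl ?desc_gen ?genK.
have sxu : gen s * x <=w gen s * u'.
  rewrite weak_le_genl ?desc_gen // genK; apply: IHn pu' skx _ => //.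
  by rewrite -weak_le_genl //; apply: weak_le_trans szw.
apply: weak_le_trans vx (weak_le_trans _ sxu).
have ixs y : inv_root x y -> pos y /\ supp (s :: c) y.
  move=> iy; split; first by case: iy.
  move=> t; have := inv_root_supp (skips_par skx) iy (t := t).
  by rewrite mem_rcons.
(* With [s] last, the Euler form of [al s] and an inversion [y] of [x] is minus the coordinate at
   [s] of the reflected root, which is positive because [s] is not a descent of [x]. *)
have alc : cone M (al s).
  apply: cone_skips skx uc1 _ _ _; first exact: pos_al.
    by move=> t; rewrite mem_rcons inE negb_or => /andP[ts _]; apply: al_neq.
  move=> y iy; have [py sy] := ixs y iy.
  have [_ /(_ s) py' _] := inv_root_refl sx iy.
  rewrite eform_rcons eform0l ?add0r ?al_id; last exact: al_notin.
  by move: py'; rewrite refl_id (pr_supp uc sy); lra.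
(* Otherwise [al s], a combination of recorded roots, would be positive at [gen s * z], which has
   [s] as a descent. *)
have [y yM npy] : exists2 y, y \in M & ~ pos (rep (gen s * z)^-1 y).
  apply: contrapT => no.
  have : pos (rep (gen s * z)^-1 (al s)).
    apply: cone_pos alc _ => y yM; apply: contrapT => npy.
    by apply: no; exists y.
  by move/descN; rewrite desc_gen sz.
(* Since [gen s * z = z * gen q], the root z^-1 y is positive but loses positivity under [q], so it
   is [al q]. *)
have yE : y = al s.
  rewrite -zq -[y](@repVK W S C z); congr (rep z _).
  apply: refl_neg_al; [exact/root_rep/(skips_root skx)|exact: pM|].
  by move: npy; rewrite (gen_conj zq) invgM genV repM rep_gen.
(* The two values of the Euler form are y'_s - sum and y'_s, with a nonnegative sum. *)
have [|r xr] := simple_skips skx uc1 yM.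
  move=> y' iy'; have [py' sy'] := ixs y' iy'; rewrite yE.
  rewrite !eform_rcons eform0l ?eform0r; try exact: al_notin.
  have := sum_kappa_ge0 sc py'; rewrite al_id.
  have -> : \sum_(t <- c) kappa s t * al s t = 0.
    by rewrite big1_seq // => t /andP[_ tc]; rewrite (al_notin sc) ?mulr0.
  by move: (\sum_(t <- c) _) => X; lra.
by apply: (@weak_le_gen_conj s r) => //; rewrite -xr yE repVK.
Qed.

End ListSorting.

(** * Parabolic factors *)

Section Parabolic.

Variables (W : groupType) (S : finType) (C : coxeterSystem W S).
Implicit Types (s : S) (A : pred S) (t u v w : W).

Local Notation R := cfield.
Local Notation gen := (cox_gen C).
Local Notation wp := (word_prod C).
Local Notation len := (cox_length C).
Local Notation V := {ffun S -> R^o}.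
Local Notation refl := (@refl W S C).
Local Notation bil := (@bil W S C).
Local Notation al := (@al S).
Local Notation rep := (@rep W S C).
Local Notation desc := (desc C).
Implicit Types (x y : V).

Lemma pos_rep_supp A u x : (forall s, A s -> ~~ desc s u) ->
  (forall s, ~~ A s -> x s = 0) -> pos x -> pos (rep u^-1 x).
Proof.
move=> Au xA px i; rewrite rep_sum sum_ffunE; apply: sumr_ge0 => s _.
rewrite scaleV; have [/Au/descN ps|/xA ->] := boolP (A s); last by rewrite mul0r.
exact: mulr_ge0.
Qed.

Lemma par_factor A w : exists v u,
  [/\ w = (v * u)%g, par C A v & forall s, A s -> ~~ desc s u].
Proof.
have [n] := ubnP (len w); elim: n w => // n IH w /ltnSE lw.
have [[s As sw]|no] := pselect (exists2 s, A s & desc s w); last first.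
  exists 1%g, w; split; [by rewrite mul1g|exact: par1|move=> s As].
  by apply/negP => sw; apply: no; exists s.
have [|v [u [e Av Au]]] := IH (gen s * w)%g; first exact: leq_trans lw.
exists (gen s * v)%g, u; split=> //; last by apply: parM => //; apply: par_gen.
by rewrite -mulgA -e genK.
Qed.

(** The root v^-1 (al s) is supported on [A], and u^-1 keeps the sign of such roots. *)
Lemma desc_par A v u s : par C A v -> (forall r, A r -> ~~ desc r u) -> A s ->
  desc s (v * u) = desc s v.
Proof.
move=> Av Au As.
have x0 r : ~~ A r -> rep v^-1 (al s) r = 0.
  move=> Ar; rewrite (par_rep _ (parV Av) Ar) al_neq //.
  by apply: contraNneq Ar => ->.
have [sv|sv] := boolP (desc s v).
  apply/descP; rewrite invgM repM -repN; apply: pos_rep_supp Au _ _.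
    by move=> r /x0 e; rewrite ffunE e oppr0.
  exact/descP.
apply/negbTE/descN; rewrite invgM repM; apply: pos_rep_supp Au _ _ => //.
exact/descN.
Qed.

Lemma len_par A v u : par C A v -> (forall s, A s -> ~~ desc s u) ->
  len (v * u)%g = (len v + len u)%N.
Proof.
have [n] := ubnP (len v); elim: n v => // n IH v /ltnSE lv Av Au.
have [->|/(@ex_desc W S C)[s sv]] := eqVneq v 1%g; first by rewrite mul1g len1.
have As := par_desc Av sv; have svu : desc s (v * u) by rewrite (desc_par Av Au As).
rewrite (len_desc sv) (len_desc svu) mulgA IH //; first exact: leq_trans lv.
by apply: parM => //; apply: par_gen.
Qed.

Definition refl_along x t := forall y, rep t y = y - bil x y *: x.

Lemma refl_along_gen s : refl_along (al s) (gen s).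
Proof. by move=> y; rewrite rep_gen /refl bil_al. Qed.

Lemma refl_along_al s t : refl_along (al s) t -> t = gen s.
Proof.
move=> tx; rewrite -genV; apply/esym/mulg1_eq/(@faithful W S C) => y.
by rewrite repM tx -(refl_along_gen s y) rep_gen rep_gen reflK.
Qed.

Lemma refl_along_conj s x t :
  refl_along x t -> refl_along (refl s x) (gen s * t * gen s)%g.
Proof.
move=> tx y; rewrite !repM !rep_gen tx -scaleNr reflD reflZ reflK scaleNr.
by rewrite -[in RHS](reflK C s y) bil_refl reflK.
Qed.

Lemma reflection_along t : reflection C t ->
  exists x, [/\ is_root C x, pos x & refl_along x t].
Proof.
case=> s [w ->].
have tx : refl_along (rep w^-1 (al s)) (gen s ^ w)%g.
  move=> y; rewrite conjgE !repM rep_gen /refl -scaleNr repD repZ repK scaleNr.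
  by rewrite -bil_al -(bil_rep C w^-1) repK.
have rx : is_root C (rep w^-1 (al s)) by apply/root_rep/root_al.
have [px|nx] := root_dich rx; first by exists (rep w^-1 (al s)).
exists (- rep w^-1 (al s)); split=> //.
  exists (w^-1 * gen s)%g, s.
  by rewrite repM rep_gen refl_al repN.
move=> y; rewrite tx; set x := rep _ _.
have -> : bil (- x) y = - bil x y by rewrite bilC -scaleN1r bilZ mulN1r bilC.
by rewrite scalerN scaleNr opprK.
Qed.

Lemma reflection_gen s : reflection C (gen s).
Proof. by exists s, 1%g; rewrite conjg1. Qed.

Lemma reflection_conj s t : reflection C t -> reflection C (gen s * t * gen s)%g.
Proof.
case=> r [w ->]; exists r, (w * gen s)%g.
by rewrite !conjgE invgM genV !mulgA.
Qed.

(** Strip a descent [s] of [w]. Unless [t] is [gen s], conjugation by [s] reduces the claim to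
    [gen s * w]; putting [s] back lengthens the left side by at most one and the right side by
    exactly one. *)
Lemma len_refl_along_neg x t w : is_root C x -> pos x -> refl_along x t ->
  pos (- rep w^-1 x) -> (len (t * w) < len w)%N.
Proof.
have [n] := ubnP (len w); elim: n x t w => // n IH x t w /ltnSE lw rx px tx nx.
have [w1|/(@ex_desc W S C)[s sw]] := eqVneq w 1%g.
  by move: nx; rewrite w1 invg1 rep1 => /(root_anti rx px).
have [xs|xs] := eqVneq x (al s).
  by rewrite xs in tx; rewrite (refl_along_al tx).
have h : (len (gen s * t * gen s * (gen s * w)) < len (gen s * w))%N.
  apply: (IH (refl s x)); [exact: leq_trans lw|exact: root_refl|exact: refl_pos|
    exact: refl_along_conj|].
  by rewrite invgM genV repM rep_gen reflK.
rewrite -mulgA genK -mulgA in h.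
rewrite (len_desc sw) ltnS -(genK C s (t * w)%g) (leq_trans (lenM _ _ _)) //.
by rewrite (leq_trans (leq_add (len_gen C s) (leqnn _))).
Qed.

(** For the converse, [t] negates [x]: if [x] were positive at [w], it would be negative at [t * w],
    and [t] would shorten [t * w] back to [w]. *)
Lemma len_refl_along x t w : is_root C x -> pos x -> refl_along x t ->
  (len (t * w) < len w)%N <-> pos (- rep w^-1 x).
Proof.
move=> rx px tx; split; last exact: len_refl_along_neg.
have tt : (t * t)%g = 1%g.
  apply: (@faithful W S C) => y; rewrite repM tx tx -scaleNr bilD bilZ root_bil //.
  rewrite -[RHS]addr0 -addrA -scaleNr -scalerDl; set k : R := _ - _.
  have -> : k = 0 by rewrite /k; ring.
  by rewrite scale0r.
have tV : t^-1%g = t by apply: mulg1_eq.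
move=> lt; have [pw|//] := root_dich (root_rep w^-1 rx).
have := @len_refl_along_neg x t (t * w)%g rx px tx.
rewrite mulgA tt mul1g invgM tV repM tx root_bil //.
have -> : x - (2 : R) *: x = - x.
  by rewrite -{1}[x]scale1r -scalerBl -scaleN1r; congr (_ *: _); ring.
by rewrite repN opprK => /(_ pw) lt'; have := ltn_trans lt lt'; rewrite ltnn.
Qed.

Lemma refl_along_par A v x t : par C A v -> is_root C x -> pos x ->
  refl_along x t -> pos (- rep v^-1 x) -> par C A t.
Proof.
have [n] := ubnP (len v); elim: n x t v => // n IH x t v /ltnSE lv Av rx px tx nx.
have [v1|/(@ex_desc W S C)[s sv]] := eqVneq v 1%g.
  by move: nx; rewrite v1 invg1 rep1 => /(root_anti rx px).
have As := par_gen C (par_desc Av sv).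
have [xs|xs] := eqVneq x (al s).
  by rewrite xs in tx; rewrite (refl_along_al tx).
have -> : t = (gen s * (gen s * t * gen s) * gen s)%g.
  by rewrite -[(gen s * t * gen s)%g]mulgA genK gen_mulK.
apply: (parM _ As); apply: (parM As).
apply: (IH (refl s x) _ (gen s * v)%g) => //.
- exact: leq_trans lv.
- exact: parM.
- exact: root_refl.
- exact: refl_pos.
- exact: refl_along_conj.
by rewrite invgM genV repM rep_gen reflK.
Qed.

(** The descents are the simple inversions, so both elements share a descent [s], and the inversions
    of the shortened elements are again determined. *)
Lemma inversions_inj v1 v2 : inversions C v1 = inversions C v2 -> v1 = v2.
Proof.
have [n] := ubnP (len v1); elim: n v1 v2 => // n IH v1 v2 /ltnSE lv e.
have dE s : desc s v1 = desc s v2.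
  suff dE v : desc s v <-> inversions C v (gen s).
    by apply/idP/idP => /dE; [rewrite e|rewrite -e] => /dE.
  by split=> [sv|[]//]; split=> //; apply: reflection_gen.
have [v11|/(@ex_desc W S C)[s sv]] := eqVneq v1 1%g.
  apply/esym; rewrite v11; apply/eqP; apply: contraT => /(@ex_desc W S C)[s].
  by rewrite -dE v11 (negPf (desc1 C s)).
have sv2 : desc s v2 by rewrite -dE.
suff : (gen s * v1 = gen s * v2)%g by apply: mulgI.
apply: IH; first exact: leq_trans lv.
(* Removing a descent [s] deletes the inversion [gen s] and conjugates all others by [s]. *)
have iE v t : desc s v -> inversions C (gen s * v)%g t <->
    reflection C t /\ t <> gen s /\ inversions C v (gen s * t * gen s)%g.
  move=> sv'; split=> [[rt lt]|[rt [ts [_ lt]]]];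
    have [x [rx px tx]] := reflection_along rt.
    have ts : t <> gen s.
      by move=> ts; move: lt; rewrite ts genK => /(ltn_trans sv'); rewrite ltnn.
    have xs : x != al s.
      by apply: contra_not_neq ts => xs; apply: refl_along_al; rewrite -xs.
    split=> //; split=> //; split; first exact: reflection_conj.
    rewrite (len_refl_along _ (root_refl s rx) (refl_pos rx px xs)
      (refl_along_conj s tx)).
    move/(len_refl_along _ rx px tx): lt.
    by rewrite invgM genV repM rep_gen.
  split=> //; rewrite (len_refl_along _ rx px tx).
  have xs : x != al s.
      by apply: contra_not_neq ts => xs; apply: refl_along_al; rewrite -xs.
  move/(len_refl_along _ (root_refl s rx) (refl_pos rx px xs)
    (refl_along_conj s tx)): lt.
  by rewrite invgM genV repM rep_gen.
by apply/seteqP; split=> t /iE; [move=> /(_ sv)|move=> /(_ sv2)] => -[rt [ts it]];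
  apply/iE => //; rewrite ?e // -?e //; split=> //; split=> //; rewrite -?e // e.
Qed.

Lemma parabolicP (J : {set S}) w : parabolic C J w <-> par C [in J] w.
Proof.
split=> [Jw|[a Ja <-] H [[H1 HM] HJ]].
  apply: Jw; split; [split; first exact: par1|].
    by move=> x y Jx Jy; apply: parM => //; apply: parV.
  by move=> x [s Js ->]; apply: par_gen.
have HV u : H u -> H u^-1%g by move=> Hu; rewrite -[u^-1%g]mul1g; apply: HM.
elim: a Ja => [|s a IH] /=; first by rewrite wp0.
case/andP=> Js /IH Ha; rewrite wp_cons -[wp a]invgK; apply: HM; last exact: HV.
by apply: HJ; exists s.
Qed.

(** The parabolic factor of [w] has the inversion set required of w_J, and [inversions_inj] leaves
    no other choice. *)
Lemma parabolic_partP w (J : {set S}) : exists u,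
  [/\ w = (parabolic_part C w J * u)%g, par C [in J] (parabolic_part C w J) &
      forall s, s \in J -> ~~ desc s u].
Proof.
have [v [u [wE Jv Ju]]] := par_factor [in J] w.
pose P v := parabolic C J v /\
  inversions C v = (inversions C w `&` parabolic C J)%classic.
have Pv : P v.
  split; first exact/parabolicP.
  apply/seteqP; split=> t.
    move=> [rt lt]; have [x [rx px tx]] := reflection_along rt.
    move/(len_refl_along _ rx px tx): lt => nx.
    split; last by apply/parabolicP; apply: refl_along_par nx.
    split=> //; apply/(len_refl_along _ rx px tx); rewrite wE invgM repM -repN.
    apply: pos_rep_supp Ju _ (nx) => s Js.
    rewrite ffunE (par_rep _ (parV Jv) Js).
    by rewrite (par_inv_root Jv (And3 rx px nx) Js) oppr0.
  move=> [[rt lt] /parabolicP Jt]; have [x [rx px tx]] := reflection_along rt.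
  split=> //; apply/(len_refl_along _ rx px tx).
  move/(len_refl_along _ rx px tx): lt => nx.
  have [pv|//] := root_dich (root_rep v^-1 rx).
  (* As an element of the parabolic subgroup, [t] preserves coordinates outside [J], yet it negates
     [x]. *)
  have xJ s : s \notin J -> x s = 0.
    move=> Js; have := par_rep x Jt Js.
    rewrite tx root_bil // !ffunE; set k := x s => e.
    have : k + - (2 * k) = k by exact: e.
    by clear; lra.
  have : pos (rep w^-1 x).
    rewrite wE invgM repM; apply: pos_rep_supp Ju _ pv => s Js.
    by rewrite (par_rep _ (parV Jv) Js) xJ.
  by move/(root_anti (root_rep _ rx)).
have [Jp ip] : P (parabolic_part C w J) by apply: xgetPex; exists v.
have -> : parabolic_part C w J = v by apply: inversions_inj; rewrite ip Pv.2.
by exists u.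
Qed.

End Parabolic.

(** * The numbers game *)

Section NumbersGame.

Variables (W : groupType) (S : finType) (C : coxeterSystem W S).
Implicit Types (s t j p q r : S) (a b c d e k : seq S) (u v w y z : W).

Local Notation R := cfield.
Local Notation gen := (cox_gen C).
Local Notation wp := (word_prod C).
Local Notation len := (cox_length C).
Local Notation "u <=w v" := (weak_le C u v) (at level 70).
Local Notation kappa := (kappa C).
Local Notation al := (@al S).
Local Notation rep := (@rep W S C).
Local Notation desc := (desc C).
Local Notation edge := (diagram_edge C).

Fixpoint legal w a : bool :=
  if a is s :: a' then desc s w && legal (gen s * w)%g a' else true.

Lemma legal_cat w a b : legal w (a ++ b) = legal w a && legal ((wp a)^-1 * w)%g b.
Proof.
elim: a w => [|s a IH] w /=; first by rewrite wp0 invg1 mul1g.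
by rewrite IH andbA wp_cons invgM genV mulgA.
Qed.

Lemma legal_rcons w a s :
  legal w (rcons a s) = legal w a && desc s ((wp a)^-1 * w)%g.
Proof. by rewrite -cats1 legal_cat /= andbT. Qed.

Lemma wpV_rcons a s w : ((wp (rcons a s))^-1 * w = gen s * ((wp a)^-1 * w))%g.
Proof. by rewrite wp_rcons invgM genV mulgA. Qed.

Lemma legal_len w a : legal w a -> len w = (size a + len ((wp a)^-1 * w)%g)%N.
Proof.
elim: a w => [|s a IH] w /=; first by rewrite wp0 invg1 mul1g.
case/andP=> sw /IH; rewrite (len_desc sw) => ->.
by rewrite wp_cons invgM genV mulgA.
Qed.

Lemma legal_le w a : legal w a -> wp a <=w w.
Proof.
move=> /legal_len lw; have := lenM C (wp a) ((wp a)^-1 * w).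
rewrite /weak_le mulVKg lw leq_add2r => le.
by rewrite (eqP (_ : len (wp a) == size a)) // eqn_leq len_le.
Qed.

Lemma legalP w a : len (wp a) = size a -> legal w a = (wp a <=w w).
Proof.
move=> la; apply/idP/idP; first exact: legal_le.
elim: a w la => //= s a IH w la aw.
have sa : ~~ desc s (wp a).
  by rewrite /desc -wp_cons la -leqNgt (leq_trans (len_le C a)).
have la' : len (wp a) = size a by move: la; rewrite wp_cons (len_ndesc sa) => -[].
have sw : desc s w.
  by apply: weak_le_desc aw _; rewrite wp_cons desc_gen.
by rewrite sw IH // -weak_le_genl // -wp_cons.
Qed.

(** The first letter is not a descent of the product of the others, which lies in a parabolic
    subgroup without it. *)
Lemma len_uniq a : uniq a -> len (wp a) = size a.
Proof.
elim: a => [|s a IH] /=; first by rewrite wp0 len1.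
case/andP=> sa /IH la; rewrite wp_cons len_ndesc ?la //.
by apply: contra sa; apply: par_desc (par_wp C (allss a)).
Qed.

Lemma legal_uniq w a : uniq a -> legal w a = (wp a <=w w).
Proof. by move=> ua; apply/legalP/len_uniq. Qed.

Lemma legal_par (A : pred S) w a : par C A w -> legal w a -> all A a.
Proof.
elim: a w => //= s a IH w Aw /andP[sw la]; have As := par_desc Aw sw.
by rewrite As (IH _ _ la) //; apply: parM => //; apply: par_gen.
Qed.

(* The position of the numbers game (Mozes) at [z]: [s] may be fired when
   [charge z s > 0], which replaces [z] by [gen s * z]. *)
Definition charge z t : R := - \sum_i rep z^-1 (al t) i.

Lemma descE s z : desc s z = (0 < charge z s).
Proof.
apply/idP/idP => [/descP n|].
  rewrite /charge -sumrN lt0r.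
  have n' i : 0 <= - rep z^-1 (al s) i by have := n i; rewrite ffunE.
  rewrite sumr_ge0 => [|i _]; last exact: n'.
  rewrite andbT psumr_neq0 => [|i _]; last exact: n'.
  apply: contraT => /hasPn no.
  have /eqP := root_neq0 (root_rep z^-1 (root_al C s)); case.
  apply/ffunP => i; apply/le_anti; rewrite ffunE -oppr_ge0 n' /=.
  have := no i (mem_index_enum _).
  by rewrite lt0r n' andbT negbK oppr_eq0 => /eqP ->.
apply: contraTT => /descN n; rewrite -leNgt /charge oppr_le0.
by apply: sumr_ge0 => i _; apply: n.
Qed.

Lemma charge_id s z : charge (gen s * z) s = - charge z s.
Proof.
rewrite /charge -!sumrN; apply: eq_bigr => i _.
by rewrite invgM genV repM rep_gen refl_al repN ffunE.
Qed.

Lemma charge_neq s t z : s != t ->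
  charge (gen s * z) t = charge z t + kappa s t * charge z s.
Proof.
move=> st; rewrite /charge mulrN mulr_sumr -opprD -big_split.
congr (- _); apply: eq_bigr => i _ /=.
by rewrite invgM genV repM rep_gen refl_al_neq // repD repZ !ffunE.
Qed.

Fixpoint taken c w : seq S :=
  if c is s :: c' then
    if desc s w then s :: taken c' (gen s * w)%g else taken c' w
  else [::].

Lemma legal_taken c w : legal w (taken c w).
Proof.
elim: c w => //= s c IH w; case: ifP => //= ->; exact: IH.
Qed.

Lemma subseq_taken c w : subseq (taken c w) c.
Proof.
elim: c w => //= s c IH w; case: ifP => _; first by rewrite eqxx; apply: IH.
exact: subseq_trans (IH w) (subseq_cons c s).
Qed.

Lemma taken_legal c w : legal w c -> taken c w = c.
Proof. by elim: c w => //= s c IH w /andP[-> /IH ->]. Qed.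

(** After a full pass through [c], the accepted letters stand behind [d] in their old order and the
    rejected ones are gone. This links the letterwise procedure with division by whole factors. *)
Lemma proj_taken c d w u :
  proj C (d ++ taken c w) ((wp (taken c w))^-1 * w)%g u ->
  proj C (c ++ d) w (wp (taken c w) * u)%g.
Proof.
elim: c d w => [|s c IH] d w /=; first by rewrite cats0 wp0 invg1 !mul1g.
have [sw|sw] := boolP (desc s w); last by move=> /IH; apply: proj_skip.
rewrite wp_cons -mulgA invgM genV -mulgA -cat_rcons => /IH p.
by apply: proj_take => //; rewrite rcons_cat.
Qed.

Lemma skips_taken c d v L : skips C (c ++ d) v L ->
  exists L', skips C (d ++ taken c v) ((wp (taken c v))^-1 * v)%g L'.
Proof.
elim: c d v L => [|s c IH] d v L /=.
  by rewrite cats0 wp0 invg1 mul1g; exists L.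
move/skips_inv; have [sv|sv] := boolP (desc s v) => -[L' sk]; last exact: IH sk.
rewrite wp_cons invgM genV -mulgA -cat_rcons; apply: (IH _ _ L').
by rewrite -rcons_cat.
Qed.

Lemma taken_skips c d v L :
  skips C (d ++ taken c v) ((wp (taken c v))^-1 * v)%g L ->
  exists L', skips C (c ++ d) v L'.
Proof.
elim: c d v L => [|s c IH] d v L /=.
  by rewrite cats0 wp0 invg1 mul1g; exists L.
have [sv|sv] := boolP (desc s v).
  rewrite wp_cons invgM genV -mulgA -cat_rcons => /IH[L' sk].
  exists (map (refl C s) L'); apply: skips_take => //.
  by rewrite rcons_cat.
by move=> /IH[L' sk]; exists (al s :: L'); apply: skips_skip.
Qed.

(* Firing more vertices only increases the charges of the remaining ones. *)
Lemma taken_mono c k y z (A : pred S) : uniq c -> subseq k c -> legal y k ->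
  (forall p, A p -> charge y p <= charge z p) -> {subset c <= A} ->
  {subset k <= taken c z} /\
  (forall p, A p -> p \notin c ->
    charge ((wp k)^-1 * y)%g p <= charge ((wp (taken c z))^-1 * z)%g p).
Proof.
elim: c k y z A => [|s c IH] k y z A /=.
  move=> _ /eqP -> _ yz _; split=> // p Ap _.
  by rewrite wp0 invg1 !mul1g; apply: yz.
case/andP=> sc uc kc lk yz cA.
(* Firing reverses the charge at [s], so from then on charges are compared only at the other
   vertices. *)
pose A' p := A p && (p != s).
have cA' : {subset c <= A'}.
  move=> p pc; apply/andP; split; first by apply: cA; rewrite inE pc orbT.
  by apply: contraNneq sc => <-.
have As : A s by apply: cA; apply: mem_head.
have [[k' kE k'c]|kc'] : (exists2 k', k = s :: k' & subseq k' c) \/ subseq k c.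
- case: (k) kc => [|r k']; first by right; apply: sub0seq.
  by have [->|_] := eqVneq r s; [left; exists k'|right].
- move: lk; rewrite kE /= => /andP[sy lk'].
  have ys : 0 < charge y s by rewrite -descE.
  have -> : desc s z by rewrite descE (lt_le_trans ys) // yz.
  have [|k't pc] := IH k' (gen s * y)%g (gen s * z)%g A' uc k'c lk' _ cA'.
    move=> p /andP[Ap ps]; rewrite !charge_neq 1?eq_sym // lerD ?yz //.
    by rewrite ler_wpM2l ?yz // kappa_ge0 // eq_sym.
  split=> [p|p Ap]; first by rewrite !inE => /orP[->//|/k't ->]; rewrite orbT.
  rewrite inE negb_or => /andP[ps pnc].
  by rewrite !wp_cons !invgM genV -!mulgA; apply: pc => //; rewrite /A' Ap.
have [sz|sz] := boolP (desc s z).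
  have [|kt pc] := IH k y (gen s * z)%g A' uc kc' lk _ cA'.
    move=> p /andP[Ap ps]; rewrite charge_neq 1?eq_sym //.
    rewrite (le_trans (yz p Ap)) // lerDl mulr_ge0 //; last by rewrite ltW -?descE.
    by rewrite kappa_ge0 // eq_sym.
  split=> [p /kt pt|p Ap]; first by rewrite inE pt orbT.
  rewrite inE negb_or => /andP[ps pnc].
  by rewrite wp_cons invgM genV -mulgA; apply: pc => //; rewrite /A' Ap.
have [|kt pc] := IH k y z A uc kc' lk yz _.
  by move=> p pc; apply: cA; rewrite inE pc orbT.
split=> [p /kt //|p Ap].
by rewrite inE negb_or => /andP[ps pnc]; apply: pc.
Qed.

Lemma sum_charge_fire s z d : s \notin d ->
  \sum_(t <- d) charge (gen s * z) t =
  \sum_(t <- d) charge z t + charge z s * \sum_(t <- d) kappa s t.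
Proof.
move=> sd; rewrite mulr_sumr -big_split; apply: eq_big_seq => t td /=.
by rewrite charge_neq 1?mulrC //; apply: contraNneq sd => ->.
Qed.

Lemma row_kappa_ge0 s d : s \notin d -> 0 <= \sum_(t <- d) kappa s t.
Proof.
move=> sd; rewrite big_seq; apply: sumr_ge0 => t td.
by apply: kappa_ge0; apply: contraNneq sd => ->.
Qed.

Lemma edgeC s t : edge s t = edge t s.
Proof. by rewrite /diagram_edge eq_sym; congr (_ && ~~ _); apply: eq_sym. Qed.

(* Firing the vertices of a cycle of the diagram one after the other would
   never stop: the partial sums of the charges stay positive. *)
Lemma no_cycle z e : cycle edge e -> (2 < size e)%N -> uniq e ->
  ~ forall i, 0 < \sum_(t <- take i.+1 e) charge z t.
Proof.
have [n] := ubnP (len z); elim: n z e => // n IH z e /ltnSE lz ce se ue pe.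
case: e ce se ue pe => [|s e] // ce se ue pe.
have sz : desc s z by rewrite descE; have := pe 0%N; rewrite /= take0 big_seq1.
have sz0 : 0 < charge z s by rewrite -descE.
have /andP[ns ue'] := ue.
apply: (IH (gen s * z)%g (rcons e s)).
- exact: leq_trans lz.
- by rewrite -rot1_cons rot_cycle.
- by rewrite size_rcons.
- by rewrite rcons_uniq.
case: e => [|t0 e] // in ce se ue pe ns ue' *.
case/lastP: e => [|e t1] // in ce se ue pe ns ue' *.
have [st0 t1s] : edge s t0 /\ edge t1 s.
  by move: ce; rewrite /= rcons_path last_rcons => /and3P[].
have kt0 : 1 <= kappa s t0 by apply: kappa_ge1.
have kt1 : 1 <= kappa s t1 by rewrite kappaC; apply: kappa_ge1.
set e' := t0 :: rcons e t1 in ns pe *.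
move=> i; have [ie|ie] := ltnP i (size e').
  rewrite -cats1 takel_cat // sum_charge_fire; last first.
    by apply: contra ns; apply: mem_take.
  apply: lt_le_trans (pe i.+1) _; rewrite /= !big_cons addrC lerD2l.
  rewrite ler_peMr ?(ltW sz0) // (le_trans kt0) // lerDl row_kappa_ge0 //.
  apply: contra ns => /mem_take; rewrite inE => ->; exact: orbT.
(* In the full sum the sign change at [s] costs twice its charge; the edges to its two neighbours
   [t0] and [t1] on the cycle pay it back. *)
rewrite take_oversize ?size_rcons // -cats1 big_cat big_seq1 charge_id /=.
rewrite sum_charge_fire //.
have := pe (size e'); rewrite take_oversize // big_cons.
move=> /lt_le_trans; apply; rewrite [X in X <= _]addrC -addrA lerD2l lerBrDr.
have -> : charge z s + charge z s = charge z s * 2 by ring.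
rewrite ler_wpM2l ?(ltW sz0) // big_cons -cats1 big_cat big_seq1 /=.
have : 0 <= \sum_(t <- e) kappa s t.
  apply: row_kappa_ge0; apply: contra ns => se'.
  by rewrite inE mem_rcons inE se' !orbT.
by move: (\sum_(t <- e) _) => X; lra.
Qed.

End NumbersGame.

(** * Orientations *)

Section Orientation.

Variables (W : groupType) (S : finType) (C : coxeterSystem W S).
Variables (o : rel S) (ho : orientation C o).
Implicit Types (s t j p q r : S) (a b c d e k : seq S) (u v w x y z : W).
Implicit Types (J K : {set S}).

Local Notation gen := (cox_gen C).
Local Notation wp := (word_prod C).
Local Notation len := (cox_length C).
Local Notation "u <=w v" := (weak_le C u v) (at level 70).
Local Notation kappa := (kappa C).
Local Notation desc := (desc C).
Local Notation al := (@al S).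
Local Notation edge := (diagram_edge C).
Local Notation legal := (legal C).
Local Notation taken := (taken C).
Local Notation charge := (charge C).
Local Notation Jmax := (Jmax C o).
Local Notation Jcand := (Jcand C o).
Local Notation acyclic := (acyclic o).
Local Notation cox_ordering := (cox_ordering o).
Local Notation cox_elt := (cox_elt C o).

Lemma subseq_rconsP d a q : subseq d (rcons a q) ->
  (exists2 d', d = rcons d' q & subseq d' a) \/ subseq d a.
Proof.
case/lastP: d => [|d r]; first by right; apply: sub0seq.
rewrite -subseq_rev !rev_rcons /=; have [->|_] := eqVneq r q.
  by rewrite subseq_rev; left; exists d.
by rewrite -rev_rcons subseq_rev; right.
Qed.

(* By induction along the path: a vertex loses its charge when it is fired, but
   its predecessor gains at least as much, an edge having weight at least 1. *)
Lemma charge_excess (A : pred S) w a d j : uniq a -> j \notin a ->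
  legal w a -> legal w (filter A a) -> subseq d a -> path edge j d ->
  ~~ A (head j d) || nilp d ->
  0 <= charge ((wp a)^-1 * w)%g j - charge ((wp (filter A a))^-1 * w)%g j
       + \sum_(t <- d) charge ((wp a)^-1 * w)%g t.
Proof.
elim/last_ind: a d => [|a q IH] d.
  by move=> _ _ _ _; rewrite subseq0 => /eqP -> _ _; rewrite big_nil subrr addr0.
rewrite rcons_uniq mem_rcons inE negb_or legal_rcons filter_rcons.
case/andP=> qa ua /andP[jq ja] /andP[la qz] lA dq pd hd.
have lA' : legal w (filter A a).
  by move: lA; case: ifP => // _; rewrite legal_rcons => /andP[].
set z := ((wp a)^-1 * w)%g in IH qz *; set y := ((wp (filter A a))^-1 * w)%g in IH *.
have z0 : 0 < charge z q by rewrite -descE.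
have yz : charge y q <= charge z q.
  have [//|_ /(_ q isT qa)] := @taken_mono _ _ C a (filter A a) w w predT ua
    (filter_subseq _ _) lA' _ (fun _ _ => isT).
  by rewrite (taken_legal la).
have kjq : 0 <= kappa q j by apply: kappa_ge0; rewrite eq_sym.
rewrite wpV_rcons -/z charge_neq 1?eq_sym //.
set y' := ((wp (if _ then _ else _))^-1 * w)%g.
have [y'E y'A] : (charge y' j <= charge y j + kappa q j * charge z q) /\
    (~~ A q -> charge y' j = charge y j).
  rewrite /y'; case: ifP => Aq; split=> //; last by rewrite lerDl mulr_ge0 // ltW.
  by rewrite wpV_rcons -/y charge_neq 1?eq_sym // lerD2l ler_wpM2l.
have [[d' dE d'a]|da] := subseq_rconsP dq; last first.
  have := IH d ua ja la lA' da pd hd.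
  have qd : q \notin d by apply: contra qa; apply: mem_subseq.
  rewrite sum_charge_fire //.
  have := row_kappa_ge0 C qd => k0; have := mulr_ge0 (ltW z0) k0.
  move: y'E; clear; move: (\sum_(t <- d) _) (charge z q * _) (kappa q j * _).
  by move=> X Y Z; lra.
have qd' : q \notin d' by apply: contra qa; apply: mem_subseq.
rewrite dE -cats1 big_cat big_seq1 charge_id sum_charge_fire //=.
move: pd; rewrite dE rcons_path => /andP[pd' eq].
have [d'0|d'n] := eqVneq d' [::].
  (* Here [q] is the only vertex on the path. It lies outside [A], so only the full play fires it,
     and its loss reappears as a gain at [j]. *)
  have Aq : ~~ A q by move: hd; rewrite dE d'0 /= orbF.
  have := IH [::] ua ja la lA' (sub0seq _) isT (orbT _).
  rewrite d'0 !big_nil (y'A Aq) !addr0 mulr0 !add0r => E.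
  have k1 : 1 <= kappa q j by apply: kappa_ge1; rewrite edgeC; move: eq; rewrite d'0.
  have := ler_wpM2r (ltW z0) k1; rewrite mul1r.
  move: E; clear; move: (kappa q j * charge z q) => X.
  by move: (charge z q) (charge z j) (charge y j) => Y Z T; lra.
have hd' : ~~ A (head j d') || nilp d'.
  by move: hd d'n; rewrite dE; case: (d') => //= r d2;
    rewrite /nilp size_rcons orbF => ->.
(* Here the predecessor of [q] on the path gains at least the charge that [q] loses. *)
have := IH d' ua ja la lA' d'a pd' hd'.
have k1 : 1 <= \sum_(t <- d') kappa q t.
  case/lastP: d' {hd' pd' d'a dE} d'n qd' eq => [//|d' r] _.
  rewrite mem_rcons inE negb_or last_rcons => /andP[qr qd'] rq.
  have kr : 1 <= kappa q r by apply: kappa_ge1; rewrite edgeC.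
  by rewrite -cats1 big_cat big_seq1 /= (le_trans kr) // lerDr row_kappa_ge0.
have := ler_wpM2l (ltW z0) k1; rewrite mulr1; move: y'E; clear.
move: (\sum_(t <- d') charge z t) (charge z q * _) (kappa q j * _) => X Y Z.
by lra.
Qed.

(** * Orderings of acyclic sets *)

Lemma o_irr s : o s s = false.
Proof. by apply/negP => /(proj1 ho); rewrite /diagram_edge eqxx. Qed.

Lemma o_anti s t : o s t -> ~~ o t s.
Proof. by move=> st; rewrite -(proj2 ho) // (proj1 ho). Qed.

Lemma o_comm s t : ~~ o s t -> ~~ o t s -> (gen s * gen t = gen t * gen s)%g.
Proof.
move=> st ts; have [->//|nst] := eqVneq s t.
apply/eqP; apply: contraNT st => nc.
by rewrite (proj2 ho) // /diagram_edge nst nc.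
Qed.

(** The pairwise form passes directly to subwords and to the pieces of a concatenation. *)
Lemma cox_orderingP J a :
  cox_ordering J a <-> perm_eq a (enum J) /\ pairwise (fun s t => ~~ o s t) a.
Proof.
split=> -[pa oa]; split=> //.
  have ua : uniq a by rewrite (perm_uniq pa) enum_uniq.
  have aJ s : s \in a -> s \in J by rewrite (perm_mem pa) mem_enum.
  case: a => [//|s0 a'] in pa oa ua aJ *; set a := s0 :: a' in pa oa ua aJ *.
  apply/(pairwiseP s0) => i k ia ka ik; apply/negP => oik.
  have := oa _ _ (aJ _ (mem_nth s0 ka)) (aJ _ (mem_nth s0 ia)) oik.
  by rewrite !index_uniq // ltnNge ltnW.
move=> s t sJ tJ ts; rewrite ltnNge leq_eqVlt; apply/negP.
have sa : s \in a by rewrite (perm_mem pa) mem_enum.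
have ta : t \in a by rewrite (perm_mem pa) mem_enum.
case/orP=> [/eqP e|lt].
  have st : t = s by rewrite -(nth_index s ta) e nth_index.
  by rewrite st o_irr in ts.
have /(pairwiseP s)/(_ _ _ _ _ lt) := oa.
by rewrite !nth_index // !inE !index_mem ta sa ts => /(_ isT isT).
Qed.

Lemma ordering_uniq J a : cox_ordering J a -> uniq a.
Proof. by case=> pa _; rewrite (perm_uniq pa) enum_uniq. Qed.

Lemma ordering_mem J a : cox_ordering J a -> a =i J.
Proof. by case=> pa _ s; rewrite (perm_mem pa) mem_enum. Qed.

(** The first letter of one ordering can be moved to the front of the other: a letter preceding it
    there follows it here, so neither direction of an edge is possible and the two commute. *)
Lemma wp_ordering a b : perm_eq a b -> uniq a ->
  pairwise (fun s t => ~~ o s t) a -> pairwise (fun s t => ~~ o s t) b ->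
  wp a = wp b.
Proof.
elim: a b => [|s a IH] b pab; first by move: pab; rewrite perm_sym => /perm_nilP ->.
have sb : s \in b by rewrite -(perm_mem pab) mem_head.
case/splitPr: sb pab => b1 b2 pab /= /andP[sa ua] /andP[oa pa].
rewrite pairwise_cat /= => /and4P[ob pb1 _ pb2].
have pab' : perm_eq a (b1 ++ b2).
  by rewrite -(perm_cons s) (perm_trans pab) // -[s :: b2]cat1s perm_catCA.
rewrite wp_cons (IH _ pab' ua pa); last first.
  by move: ob; rewrite allrel_consr pairwise_cat pb1 pb2 => /andP[_ ->].
rewrite !wp_cat wp_cons !mulgA; congr (_ * _)%g.
have : {in b1, forall t, (gen s * gen t = gen t * gen s)%g}.
  move=> t tb1; apply: o_comm; last first.
    by move/allrelP: ob => /(_ t s tb1 (mem_head _ _)).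
  by move/allP: oa; apply; rewrite (perm_mem pab') mem_cat tb1.
elim: b1 {IH pab pab' ob pb1} => [|t b1 IH] cb1; first by rewrite wp0 mulg1 mul1g.
rewrite wp_cons mulgA cb1 ?mem_head // -!mulgA; congr (_ * _)%g.
by apply: IH => r rb; apply: cb1; rewrite inE rb orbT.
Qed.

Lemma cox_eltE J a : cox_ordering J a -> cox_elt J = wp a.
Proof.
move=> Ja; have Jb : cox_ordering J (xget [::] (cox_ordering J)).
  by apply: xgetPex; exists a.
have [pa oa] := (cox_orderingP J a).1 Ja.
have [pb ob] := (cox_orderingP J _).1 Jb.
apply: wp_ordering ob oa; last exact: ordering_uniq Jb.
by rewrite (perm_trans pb) // perm_sym.
Qed.

Lemma ordering_subseq J a b : cox_ordering J a -> subseq b a ->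
  cox_ordering [set s in b] b.
Proof.
move=> Ja ba; have [pa oa] := (cox_orderingP J a).1 Ja.
apply/cox_orderingP; split; last exact: subseq_pairwise ba oa.
apply: uniq_perm; rewrite ?enum_uniq ?(subseq_uniq ba (ordering_uniq Ja)) //.
by move=> s; rewrite mem_enum inE.
Qed.

Lemma ordering_filter J K a : cox_ordering J a -> K \subset J ->
  cox_ordering K (filter [in K] a).
Proof.
move=> Ja KJ; have := ordering_subseq Ja (filter_subseq [in K] a).
congr cox_ordering; apply/finset.setP => s; rewrite inE mem_filter /=.
by have [/(fintype.subsetP KJ)|//] := boolP (s \in K); rewrite (ordering_mem Ja).
Qed.

Lemma acyclic_sub J K : K \subset J -> acyclic J -> acyclic K.
Proof.
move=> KJ /asboolP aJ; apply/asboolP => p p0 pK; apply: aJ => // s /pK.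
exact: (fintype.subsetP KJ).
Qed.

(** Otherwise an arrow within [J] leaves every vertex, and following such arrows in a finite set
    closes a directed cycle. *)
Lemma acyclic_first J : acyclic J -> J != finset.set0 ->
  exists2 s, s \in J & forall t, t \in J -> ~~ o s t.
Proof.
move=> /asboolP aJ /set0Pn[s0 s0J].
apply: contrapT => no.
have next s : exists t, s \in J -> t \in J /\ o s t.
  have [sJ|sJ] := boolP (s \in J); last by exists s.
  apply: contrapT => nt; apply: no; exists s => // t tJ.
  by apply/negP => st; apply: nt; exists t.
pose f s := sval (cid (next s)).
have fP s : s \in J -> f s \in J /\ o s (f s) by exact: svalP (cid (next s)).
have fJ n : iter n f s0 \in J by elim: n => //= n /fP[].
pose N := #|S|; have : looping f s0 N.
  rewrite -[looping _ _ _]negbK -looping_uniq; apply/negP => u.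
  have := uniq_leq_size u (fun (s : S) _ => mem_enum S s).
  by rewrite size_traject -cardE ltnn.
rewrite /looping => /trajectP[i iN e].
set y := iter i f s0 in e; have Ny : iter (N - i) f y = y.
  by rewrite /y -iterD subnK // ltnW.
have yJ n : iter n f y \in J by rewrite /y -iterD fJ.
pose p := traject f y (N - i).
have pJ : {subset p <= J} by move=> s /trajectP[n _ ->].
have : p != [::] by rewrite -size_eq0 size_traject subn_eq0 -ltnNge.
move=> /aJ/(_ pJ)/negP; apply; rewrite /p.
case: (N - i)%N Ny => [//|n] Ny; rewrite trajectS /=.
have -> : rcons (traject f (f y) n) y = traject f (f y) n.+1.
  by rewrite trajectSr -iterSr Ny.
elim: n.+1 {Ny} (y) (yJ 0%N) => //= k IH s sJ; have [fsJ ofs] := fP _ sJ.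
by rewrite ofs IH.
Qed.

Lemma ex_ordering J : acyclic J -> exists a, cox_ordering J a.
Proof.
have [n] := ubnP #|J|; elim: n J => // n IH J /ltnSE cJ aJ.
have [->|J0] := eqVneq J finset.set0.
  exists [::]; split=> [|s t]; last by rewrite inE.
  by rewrite enum_set0.
have [s sJ os] := acyclic_first aJ J0.
have [||a aE] := IH (J :\ s)%SET.
- by apply: leq_trans cJ; rewrite [X in (_ < X)%N](cardsD1 s) sJ.
- by apply: acyclic_sub aJ; apply: subsetDl.
have [pa oa] := (cox_orderingP _ a).1 aE.
exists (s :: a); apply/cox_orderingP; split.
  apply: uniq_perm; rewrite ?enum_uniq //=.
    by rewrite (ordering_uniq aE) (ordering_mem aE) !inE eqxx.
  move=> t; rewrite inE (ordering_mem aE) mem_enum !inE.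
  by have [->|] := eqVneq t s.
rewrite pairwise_cons oa andbT; apply/allP => t.
by rewrite (ordering_mem aE) !inE => /andP[_ /os].
Qed.

(** * Existence of a largest candidate set *)

Lemma JcandE J a w : acyclic J -> cox_ordering J a -> Jcand w J = legal w a.
Proof.
move=> aJ Ja; rewrite /Defs.Jcand aJ (cox_eltE Ja).
by rewrite legal_uniq // (ordering_uniq Ja).
Qed.

Lemma Jcand_legal J a w : Jcand w J -> cox_ordering J a -> legal w a.
Proof. by move=> cJ Ja; have [aJ _] := andP cJ; rewrite -(JcandE _ aJ Ja). Qed.

Lemma Jcand0 w : Jcand w finset.set0.
Proof.
have a0 : acyclic finset.set0.
  by apply/asboolP => -[|s p] // _ /(_ s (mem_head _ _)); rewrite inE.
rewrite (JcandE _ a0 (a := [::])) //; split=> [|s t]; last by rewrite inE.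
by rewrite enum_set0.
Qed.

Lemma Jmax_maxset w : maxset (Jcand w) (Jmax w).
Proof.
rewrite /Defs.Jmax; case: pickP => [//|no].
by have [J] := maxset_exists (Jcand0 w); rewrite no.
Qed.

Lemma Jmax_cand w : Jcand w (Jmax w).
Proof. exact: maxsetp (Jmax_maxset w). Qed.

Lemma sorted_index_subseq a d : uniq a -> {subset d <= a} ->
  sorted (fun s t => (index s a < index t a)%N) d -> subseq d a.
Proof.
move=> ua da sd.
have tr : transitive (fun s t => (index s a < index t a)%N).
  by move=> t s r; apply: ltn_trans.
have -> : d = filter [in d] a; last exact: filter_subseq.
apply: (irr_sorted_eq tr) => //; first by move=> s; rewrite ltnn.
  apply: (sorted_filter tr); case: (a) ua => // s0 b ub.
  by apply/(sortedP s0) => i ib; rewrite !index_uniq // ltnW.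
by move=> s; rewrite mem_filter /=; have [/da|//] := boolP (s \in d).
Qed.

Lemma wp_filter J a b : cox_ordering J a -> uniq b ->
  pairwise (fun s t => ~~ o s t) b -> {subset b <= a} ->
  wp (filter [in b] a) = wp b.
Proof.
move=> Ja ub ob ba; have ua := ordering_uniq Ja.
apply: wp_ordering ob; last 1 first.
- have [_ oa] := (cox_orderingP J a).1 Ja.
  exact: subseq_pairwise (filter_subseq _ _) oa.
- apply: uniq_perm; rewrite ?filter_uniq // => s; rewrite mem_filter /=.
  by have [/ba|//] := boolP (s \in b).
- exact: filter_uniq.
Qed.

Lemma legal_filter J w a b : cox_ordering J a -> uniq b ->
  pairwise (fun s t => ~~ o s t) b -> {subset b <= a} ->
  legal w (filter [in b] a) = legal w b.
Proof.
move=> Ja ub ob ba; rewrite !legal_uniq ?filter_uniq ?(ordering_uniq Ja) //.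
by rewrite (wp_filter Ja).
Qed.

Lemma subset_taken c w : uniq c -> {subset c <= taken c w} -> legal w c.
Proof.
move=> uc ct; have le := size_subseq_leqif (subseq_taken C c w).
have : taken c w == c by rewrite -le eqn_leq le uniq_leq_size.
by move/eqP <-; apply: legal_taken.
Qed.

(** Play an ordering of the enlarged set greedily. An ordering of [J] and one of the letters of
    [rcons b j] are legal subwords of it, and by [taken_mono] the letters of both are taken, which
    is all letters. *)
Lemma Jcand_add w J j b : Jcand w J -> acyclic (j |: J)%SET ->
  uniq (rcons b j) -> pairwise (fun s t => ~~ o s t) (rcons b j) ->
  {subset b <= J} -> legal w (rcons b j) -> Jcand w (j |: J)%SET.
Proof.
move=> cJ aj ub ob bJ lb; have [c cE] := ex_ordering aj.
have uc := ordering_uniq cE; rewrite (JcandE _ aj cE).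
have sub k : subseq k c -> legal w k -> {subset k <= taken c w}.
  move=> kc lk.
  by have [] := @taken_mono _ _ C c k w w predT uc kc lk _ (fun _ _ => isT).
have bc : {subset rcons b j <= c}.
  move=> s; rewrite mem_rcons inE (ordering_mem cE) !inE.
  by case/orP=> [->|/bJ ->]; rewrite ?orbT.
apply: subset_taken => // s sc.
have := sc; rewrite (ordering_mem cE) !inE => /orP[/eqP sj|sJ].
  apply: (sub (filter [in rcons b j] c) (filter_subseq _ _)).
    by rewrite (legal_filter _ cE).
  by rewrite mem_filter sc /= sj mem_rcons mem_head.
apply: (sub (filter [in J] c) (filter_subseq _ _)).
  apply: Jcand_legal cJ _; apply: ordering_filter cE _; exact: finset.subsetUr.
by rewrite mem_filter sc /= sJ.
Qed.

(** A directed cycle must pass through [j], and the vertex with the arrow into [j] is not in [b],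
    because [b] precedes [j] in an ordering. Compare the play of all of [J] with the play of [b],
    after which [j] has positive charge: [charge_excess] makes the partial sums along the cycle
    positive, against [no_cycle]. *)
Lemma acyclic_add w J j b : Jcand w J -> uniq (rcons b j) ->
  pairwise (fun s t => ~~ o s t) (rcons b j) ->
  {subset b <= J} -> legal w (rcons b j) -> acyclic (j |: J)%SET.
Proof.
move=> cJ ub ob bJ lb; have [aJ _] := andP cJ.
have [a aE] := ex_ordering aJ; have ua := ordering_uniq aE.
apply: contraT => naJ.
have [p [p0 pJ cp]] : exists p : seq S,
    [/\ p != [::], {subset p <= (j |: J)%SET} & cycle o p].
  apply: contrapT => no; case/negP: naJ; apply/asboolP => p p0 pJ.
  by apply/negP => cp; apply: no; exists p.
have jp : j \in p.
  apply: contraT => jp; move/asboolP: aJ => /(_ p p0) /(_ _)/negP; case=> // s sp.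
  have := pJ s sp; rewrite !inE => /orP[/eqP sj|//].
  by rewrite sj (negPf jp) in sp.
have [i p' rE] := rot_to jp.
have : cycle o (j :: p') by rewrite -rE rot_cycle.
have p'J : {subset p' <= (j |: J)%SET}.
  by move=> s sp'; apply: pJ; rewrite -(mem_rot i) rE inE sp' orbT.
rewrite /= rcons_path => /andP[]; case/shortenP => d' pd' ud' sd' od'.
have [jd' u'] := andP ud'.
have jJ : j \notin J.
  apply: contraNN naJ => jJ; suff -> : (j |: J)%SET = J by [].
  by apply/finset.setUidPr; rewrite finset.sub1set.
have d'J s : s \in d' -> s \in J.
  move=> sd; have := p'J s (sd' s sd); rewrite !inE => /orP[/eqP sj|//].
  by rewrite sj (negPf jd') in sd.
(* Arrows point from later to earlier letters of an ordering, so the reversed path is a subword of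
   [a]. *)
pose d := rev d'.
have ja : j \notin a by rewrite (ordering_mem aE).
have da : subseq d a.
  apply: sorted_index_subseq => //.
    by move=> s; rewrite mem_rev (ordering_mem aE); apply: d'J.
  rewrite rev_sorted; have := path_sorted pd'.
  apply: (@sub_in_sorted _ [in J]); last by apply/allP => s /d'J.
  by move=> s t sJ tJ; have [_] := aE; apply.
have cd : cycle edge (j :: d).
  rewrite -(rot_cycle 1) rot1_cons /d -rev_cons rev_cycle.
  apply: (@sub_cycle _ o); first by move=> s t /(proj1 ho); rewrite edgeC.
  by rewrite /= rcons_path pd'.
have pd : path edge j d by move: cd; rewrite /= rcons_path => /andP[].
have bj : ~~ (head j d \in b).
  apply/negP => hb; move: ob; rewrite pairwise_rcons => /andP[/allP/(_ _ hb)].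
  suff -> : head j d = last j d' by rewrite od'.
  by rewrite /d; case/lastP: (d') => // q r; rewrite rev_rcons last_rcons.
have lz : legal w a := Jcand_legal cJ aE.
have ub1 : uniq b by move: ub; rewrite rcons_uniq => /andP[].
have ob1 : pairwise (fun s t => ~~ o s t) b.
  by move: ob; rewrite pairwise_rcons => /andP[].
have ba : {subset b <= a} by move=> s /bJ; rewrite (ordering_mem aE).
move: lb; rewrite legal_rcons -(legal_filter w aE ub1 ob1 ba) => /andP[lb].
rewrite -(wp_filter aE ub1 ob1 ba) descE => jb.
exfalso; apply: (@no_cycle _ _ C ((wp a)^-1 * w)%g (j :: d) cd).
- rewrite /= size_rev; case: (d') pd' od' => [|q [|r d2]] //=.
    by rewrite o_irr.
  by rewrite andbT => /o_anti/negPf ->.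
- by rewrite /= mem_rev rev_uniq.
move=> n; rewrite /= big_cons.
(* Every initial segment of [d] either is empty or starts outside [b], so the estimate applies to
   all partial sums. *)
have := @charge_excess [in b] w a (take n d) j ua ja lz lb.
move=> /(_ (subseq_trans (take_subseq _ _) da) (take_path n pd)).
have -> : ~~ [in b] (head j (take n d)) || nilp (take n d).
  by move: bj; case: (d) n => [|r d2] [|n] //= h; apply/orP;
    [right|right|right|left].
move=> /(_ isT); move: jb; clear; move: (\sum_(t <- _) _) => X.
by move: (charge _ j) (charge _ j) => Y Z; lra.
Qed.

(** If not, take the first letter, in an ordering of [K], outside the chosen maximal set. The
    letters before it lie in that set, so it can be added, against maximality. *)
Lemma Jmax_greatest w K : Jcand w K -> K \subset Jmax w.
Proof.
move=> cK; have [aK _] := andP cK; have [a aE] := ex_ordering aK.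
have cJ := Jmax_cand w; have [_ oa] := (cox_orderingP K a).1 aE.
apply/fintype.subsetP => s sK; apply: contraT => sJ.
have : has [predC Jmax w] a by apply/hasP; exists s; rewrite ?(ordering_mem aE).
move=> h; have la := Jcand_legal cK aE; have ua := ordering_uniq aE.
move: h oa la ua => /split_find; case=> j b1 b2 jJ b1J.
rewrite pairwise_cat legal_cat cat_uniq.
move=> /and3P[_ ob _] /andP[lb _] /andP[ub _].
have bJ : {subset b1 <= Jmax w}.
  by move=> t tb; apply: contraT => tJ; case/negP: b1J; apply/hasP; exists t.
have aj := acyclic_add cJ ub ob bJ lb.
have cj := Jcand_add cJ aj ub ob bJ lb.
have e := maxsetsup (Jmax_maxset w) cj (finset.subsetUr _ _).
by case/negP: jJ; rewrite -e inE set11.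
Qed.

Lemma Jmax_par (K : {set S}) w : par C [in K] w -> Jmax w \subset K.
Proof.
move=> Kw; have cJ := Jmax_cand w; have [aJ _] := andP cJ.
have [a aE] := ex_ordering aJ; have := legal_par Kw (Jcand_legal cJ aE).
move=> /allP aK; apply/fintype.subsetP => s sJ.
by apply: aK; rewrite (ordering_mem aE).
Qed.

Lemma desc_Jmax s w : desc s w -> s \in Jmax w.
Proof.
move=> sw; suff /Jmax_greatest : Jcand w [set s] by rewrite finset.sub1set.
have sE : cox_ordering [set s] [:: s].
  by apply/cox_orderingP; rewrite enum_set1.
have as1 : acyclic [set s].
  apply/asboolP => -[|r p] // _ pS; apply/negP.
  have e t : t \in r :: p -> t = s by move=> /pS; rewrite inE => /eqP.
  have -> : r = s by apply/e/mem_head.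
  case: p e {pS} => [|q p] e; first by rewrite /= o_irr.
  by rewrite /= (e q) ?o_irr // !inE eqxx orbT.
by rewrite (JcandE _ as1 sE) /= sw.
Qed.

Lemma Jmax_neq0 w : w != 1%g -> Jmax w != finset.set0.
Proof.
by move=> /(@ex_desc W S C)[s /desc_Jmax sJ]; apply/set0Pn; exists s.
Qed.

(** * One greedy pass extracts the factor of the largest candidate set *)

Section OnePass.

Variables (J : {set S}) (c : seq S) (x : W).
Hypotheses (aJ : acyclic J) (cE : cox_ordering J c) (xJ : Jmax x \subset J).

Let k := filter [in Jmax x] c.

Lemma ordering_Jmax : cox_ordering (Jmax x) k.
Proof. exact: ordering_filter cE xJ. Qed.

Lemma legal_Jmax : legal x k.
Proof. exact: Jcand_legal (Jmax_cand x) ordering_Jmax. Qed.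

(** The letters taken form a candidate set, hence lie in the largest one; conversely [taken_mono]
    shows that every letter of the legal subword [k] is taken. *)
Lemma taken_Jmax : taken c x = k.
Proof.
have uc := ordering_uniq cE; have tc := subseq_taken C c x.
rewrite {1}(subseq_uniqP uc tc); apply: eq_in_filter => s sc /=.
apply/idP/idP => [st|sx].
  have tE := ordering_subseq cE tc.
  have tJ : finset (mem (taken c x)) \subset J.
    apply/fintype.subsetP => r; rewrite inE => /(mem_subseq tc).
    by rewrite (ordering_mem cE).
  have /Jmax_greatest/fintype.subsetP : Jcand x [set r in taken c x].
    by rewrite (JcandE _ (acyclic_sub tJ aJ) tE) legal_taken.
  by apply; rewrite inE.
have [kt _] := @taken_mono _ _ C c k x x predT uc (filter_subseq _ _) legal_Jmax
  (fun _ _ => lexx _) (fun _ _ => isT).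
by apply: kt; rewrite mem_filter sc /= sx.
Qed.

Lemma len_Jmax : x != 1%g -> (len ((cox_elt (Jmax x))^-1 * x) < len x)%N.
Proof.
move=> x1; rewrite (cox_eltE ordering_Jmax) (legal_len legal_Jmax).
rewrite -[X in (X < _)%N]add0n ltn_add2r lt0n size_eq0.
apply: contraNneq (Jmax_neq0 x1) => k0; apply/eqP/finset.setP => s.
by rewrite -(ordering_mem ordering_Jmax) k0 finset.in_set0.
Qed.

End OnePass.

(** * Sortability and the recursion, read along a word *)

Lemma Jmax1 : Jmax 1%g = finset.set0.
Proof. by apply/eqP; rewrite -finset.subset0; apply/Jmax_par/par1. Qed.

Lemma cox_elt0 : cox_elt finset.set0 = 1%g.
Proof.
by rewrite (@cox_eltE _ [::]) ?wp0 //; apply/cox_orderingP; rewrite enum_set0.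
Qed.

Lemma sort_seqS v i :
  sort_seq C o v i.+1 = sort_seq C o ((cox_elt (Jmax v))^-1 * v)%g i.
Proof. exact: iterSr. Qed.

Lemma sortable1 : sortable C o 1%g.
Proof.
have e i : sort_seq C o 1%g i = 1%g.
  elim: i => // i IH; rewrite sort_seqS Jmax1 cox_elt0 mulg1 invg1; exact: IH.
by move=> i; rewrite !e.
Qed.

Lemma sortableP v : sortable C o v <->
  Jmax ((cox_elt (Jmax v))^-1 * v)%g \subset Jmax v /\
  sortable C o ((cox_elt (Jmax v))^-1 * v)%g.
Proof.
split=> [sv|[v0 sv] [|i]]; last 2 first.
- exact: v0.
- by rewrite (sort_seqS v i.+1) (sort_seqS v i); apply: sv.
split=> [|i]; first exact: (sv 0%N).
by have := sv i.+1; rewrite (sort_seqS v i.+1) (sort_seqS v i).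
Qed.

Lemma skips1 c : exists L, skips C c 1%g L.
Proof.
elim: c => [|s c [L sk]]; first by exists [::]; apply: skips_nil.
by exists (al s :: L); apply: skips_skip => //; apply: desc1.
Qed.

(** Nesting of the sets allows each pass to use only the letters accepted in the previous one, and
    [taken_skips] joins the passes into one run. *)
Lemma sortable_skips v J c : acyclic J -> cox_ordering J c -> Jmax v \subset J ->
  sortable C o v -> exists L, skips C c v L.
Proof.
have [n] := ubnP (len v); elim: n v J c => // n IH v J c /ltnSE lv aJ cE vJ.
have [->|v1] := eqVneq v 1%g; first by move=> _; apply: skips1.
move=> /sortableP[v'J sv'].
have kE := ordering_Jmax cE vJ.
have [|L sk] := IH _ _ _ _ (acyclic_sub vJ aJ) kE v'J sv'.
  exact: leq_trans (len_Jmax cE vJ v1) lv.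
have [|L' sk'] := @taken_skips _ _ C c [::] v L; last first.
  by exists L'; rewrite cats0 in sk'.
by rewrite (taken_Jmax aJ cE vJ) cat0s -(cox_eltE kE).
Qed.

(** After a pass the remainder lies in the parabolic subgroup of the accepted letters, which forces
    the next set to be contained in the present one. *)
Lemma skips_sortable v J c L : acyclic J -> cox_ordering J c ->
  skips C c v L -> sortable C o v.
Proof.
have [n] := ubnP (len v); elim: n v J c L => // n IH v J c L /ltnSE lv aJ cE sk.
have vJ : Jmax v \subset J.
  apply: Jmax_par; apply: par_sub (skips_par sk) => s /=.
  by rewrite (ordering_mem cE).
have [->|v1] := eqVneq v 1%g; first exact: sortable1.
have kE := ordering_Jmax cE vJ.
have [|L' sk'] := @skips_taken _ _ C c [::] v L; first by rewrite cats0.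
rewrite (taken_Jmax aJ cE vJ) cat0s -(cox_eltE kE) in sk'.
apply/sortableP; split.
  apply: Jmax_par; apply: par_sub (skips_par sk') => s /=.
  by rewrite (ordering_mem kE).
apply: IH (acyclic_sub vJ aJ) kE sk'.
exact: leq_trans (len_Jmax cE vJ v1) lv.
Qed.

Lemma proj1g c : proj C c 1%g 1%g.
Proof.
by elim: c => [|s c IH]; [apply: proj_nil|apply: proj_skip => //; apply: desc1].
Qed.

(** The procedure tests only descents in [A], and these do not see the right factor [u]. *)
Lemma proj_par (A : pred S) c v u x : all A c -> par C A v ->
  (forall s, A s -> ~~ desc s u) -> proj C c v x -> proj C c (v * u)%g x.
Proof.
move=> Ac Av Au p; elim: p Ac Av => {c v x} [v|s c v x sv _ IH|s c v x sv _ IH] /=.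
- by move=> _ _; apply: proj_nil.
- case/andP=> As Ac Av; apply: proj_take; first by rewrite (desc_par Av Au As).
  rewrite mulgA; apply: IH; first by rewrite all_rcons As.
  by apply: parM => //; apply: par_gen.
case/andP=> As Ac Av; apply: proj_skip; last exact: IH.
by rewrite (desc_par Av Au As).
Qed.

Lemma legal_par_factor (A : pred S) v u a : all A a -> par C A v ->
  (forall s, A s -> ~~ desc s u) -> legal (v * u)%g a = legal v a.
Proof.
move=> Aa Av Au; elim: a v Aa Av => //= s a IH v /andP[As Aa] Av.
rewrite (desc_par Av Au As) mulgA IH //.
by apply: parM => //; apply: par_gen.
Qed.

(** This shows both that the recursion terminates and that the letterwise projection computes it.
    Replacing [x] by its parabolic part has no effect on the projection, by [proj_par]. *)
Lemma proj_pi_graph x J c : acyclic J -> cox_ordering J c -> Jmax x \subset J ->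
  exists2 u, proj C c x u & pi_graph C o x u.
Proof.
have [n] := ubnP (len x); elim: n x J c => // n IH x J c /ltnSE lx aJ cE xJ.
have [->|x1] := eqVneq x 1%g; first by exists 1%g; [apply: proj1g|apply: pi_graph_1].
have kE := ordering_Jmax cE xJ; set k := filter _ c in kE.
have aK := acyclic_sub xJ aJ.
have [u [xE Kv Ku]] := parabolic_partP C x (Jmax x).
set v := parabolic_part C x (Jmax x) in xE Kv.
have Kk : all [in Jmax x] k by apply/allP => s; rewrite (ordering_mem kE).
have lv : legal v k.
  by rewrite -(legal_par_factor Kk Kv Ku) -xE; apply: legal_Jmax cE xJ.
have Kv' : par C [in Jmax x] ((wp k)^-1 * v)%g.
  by apply: parM Kv; apply/parV/par_wp.
have ln : (len ((wp k)^-1 * v)%g < n)%N.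
  apply: leq_trans lx; apply: leq_trans (len_Jmax cE xJ x1).
  rewrite ltnS (cox_eltE kE) xE mulgA (len_par Kv' Ku); exact: leq_addr.
have [y py gy] := IH _ _ _ ln aK kE (Jmax_par Kv').
exists (wp k * y)%g; last first.
  by rewrite -(cox_eltE kE); apply: pi_graph_step => //; rewrite (cox_eltE kE).
have tk : taken c x = k := taken_Jmax aJ cE xJ.
have {}py := proj_par Kk Kv' Ku py; rewrite -mulgA -xE in py.
by have := @proj_taken _ _ C c [::] x y; rewrite cats0 tk; apply.
Qed.

Theorem pi_down_greatest w :
  [/\ sortable C o (pi_down C o w), pi_down C o w <=w w &
      forall v, sortable C o v -> v <=w w -> v <=w pi_down C o w].
Proof.
have [aJ _] := andP (Jmax_cand w); have [c cE] := ex_ordering aJ.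
have [u pu gu] := proj_pi_graph aJ cE (subxx _).
(* A value of the recursion exists, so the default of [xget] does not occur. *)
have -> : pi_down C o w = u.
  have gp : pi_graph C o w (pi_down C o w) by apply: xgetPex; exists u.
  exact: pi_graph_fun gp gu.
have [uw [L sk _]] := proj_spec pu.
split=> // [|v sv vw]; first exact: skips_sortable aJ cE sk.
(* Hence a single ordering [c], of the set of [w], serves for all sortable elements below [w]. *)
have vJ : Jmax v \subset Jmax w.
  apply: Jmax_greatest; have [aV vV] := andP (Jmax_cand v).
  by rewrite /Defs.Jcand aV (weak_le_trans vV vw).
have [M skv] := sortable_skips aJ cE vJ sv.
exact: proj_greatest (ordering_uniq cE) pu skv vw.
Qed.

End Orientation.

Theorem proposition1p1 (W : groupType) (S : finType) (C : coxeterSystem W S)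
    (o : rel S) (ho : orientation C o) (w : W) :
  unique (maximal_weak C (fun v : W => sortable C o v /\ weak_le C v w))
         (pi_down C o w).
Proof.
have [sp pw pmax] := pi_down_greatest ho w.
split=> [|v [[sv vw] vmax]].
  by split=> // u [su uw] pu; apply: weak_le_anti pu; apply: pmax.
by apply: vmax => //; apply: pmax.
Qed.
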